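(* Let $N\in\mathcal{LC}$ satisfy $(\beta_3)$, and let $[\cdot]$ denote one fixed type, Roumieu $\{\cdot\}$ or Beurling $(\cdot)$ (the theorem holds for either type). The following are equivalent: (i) There exists $\omega\in\mathcal{W}$ such that $\mathcal{E}_{[\omega]}=\mathcal{E}_{[N]}$. (ii) $N$ satisfies (mg). (iii) $\mathcal{E}_{[\omega_N]}=\mathcal{E}_{[N]}$. Let $\omega$ be as in (i) and $\Omega=\{\Omega^l:l>0\}$ with $\Omega^l_j:=\exp(\frac1l\varphi^*_\omega(lj))$. Then for each $l>0$: (a) $\omega,\omega_{\Omega^l},\omega_N\in\mathcal{W}$ satisfy $(\omega_6)$; (b) $\omega_{\Omega^l}\sim\omega\sim\omega_N$; (c) $\mathcal{E}_{[\omega_N]}=\mathcal{E}_{[N]}=\mathcal{E}_{[\omega]}=\mathcal{E}_{[\Omega^l]}$; (d) $N\approx\Omega^l$; (e) $\Omega^l$ satisfies (mg); (f) if $\liminf_{p\to\infty}(N_p/p!)^{1/p}>0$, then $\omega$, $\omega_N$ and each $\omega_{\Omega^l}$ satisfy $(\omega_2)$, each $\Omega^l$ satisfies $(\beta_3)$, and $\liminf_{p\to\infty}(\Omega^l_p/p!)^{1/p}>0$ for all $l>0$; if $\lim_{p\to\infty}(N_p/p!)^{1/p}=+\infty$, then $\omega$, $\omega_N$ and each $\omega_{\Omega^l}$ satisfy $(\omega_5)$, and $\lim_{p\to\infty}(\Omega^l_p/p!)^{1/p}=+\infty$ for all $l>0$.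
   Context: $\mathbb{N}=\{0,1,2,\dots\}$. $\mathcal{W}$ is the set of functions $\omega:[0,\infty)\to[0,\infty)$ that are continuous, increasing, vanish on $[0,1]$, tend to $+\infty$, satisfy $\log t=o(\omega(t))$ as $t\to\infty$, are such that $\varphi_\omega:t\mapsto\omega(e^t)$ is convex on $\mathbb{R}$, and satisfy $(\omega_1)$: $\omega(2t)=O(\omega(t))$ as $t\to\infty$. Further conditions: $(\omega_2)$: $\omega(t)=O(t)$ as $t\to\infty$; $(\omega_5)$: $\omega(t)=o(t)$ as $t\to\infty$; $(\omega_6)$: $\exists H\ge1\ \forall t\ge0:\ 2\omega(t)\le\omega(Ht)+H$. $\sigma\sim\tau$ means $\sigma(t)=O(\tau(t))$ and $\tau(t)=O(\sigma(t))$ as $t\to\infty$. Put $\varphi^*_\omega(x):=\sup\{xy-\varphi_\omega(y):y\ge0\}$. $\mathcal{LC}$ is the set of sequences $M=(M_k)_{k\in\mathbb{N}}$ of positive reals with $1=M_0\le M_1$, $M_j^2\le M_{j-1}M_{j+1}$ for $j\ge1$, and $\lim_{k}(M_k)^{1/k}=+\infty$. (mg): $\exists C\ge1\ \forall j,k:\ M_{j+k}\le C^{j+k}M_jM_k$. $(\beta_3)$: with $\mu_k:=M_k/M_{k-1}$, $\exists Q\in\mathbb{N}_{>0}:\ \liminf_{p\to\infty}\mu_{Qp}/\mu_p>1$. $M\preceq N$ means $\sup_{p\ge1}(M_p/N_p)^{1/p}<\infty$, and $M\approx N$ means $M\preceq N$ and $N\preceq M$. Associated function: $\omega_M(t):=\sup_{p\in\mathbb{N}}\log(t^p/M_p)$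 for $t>0$, $\omega_M(0):=0$. Classes: for $U\subseteq\mathbb{R}^r$ non-empty open and smooth $f:U\to\mathbb{R}^s$ put $\|f\|_{M,K,h}:=\sup_{k\in\mathbb{N},x\in K}\|f^{(k)}(x)\|/(h^kM_k)$ and $\|f\|_{\omega,K,l}:=\sup_{k\in\mathbb{N},x\in K}\|f^{(k)}(x)\|/\exp(\frac1l\varphi^*_\omega(lk))$ (Fréchet derivatives, operator norm). $\mathcal{E}_{\{M\}}(U,\mathbb{R}^s)$ and $\mathcal{E}_{\{\omega\}}(U,\mathbb{R}^s)$ consist of those $f$ such that for every compact $K\subset U$, respectively $\|f\|_{M,K,h}<\infty$ for some $h>0$; $\|f\|_{\omega,K,l}<\infty$ for some $l>0$. The Beurling classes $\mathcal{E}_{(M)},\mathcal{E}_{(\omega)}$ are defined with ''for all'' in place of ''for some''. Equality of classes, $\mathcal{E}_\star=\mathcal{E}_{\star'}$, means equality for all non-empty open $U\subseteq\mathbb{R}^r$ and all $r,s$. *)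

(* Defs.v *)
From mathcomp Require Export all_boot all_order all_algebra.
From mathcomp Require Export all_classical all_reals all_analysis.

Set Implicit Arguments.
Unset Strict Implicit.
Unset Printing Implicit Defensive.

Export Order.TTheory GRing.Theory Num.Theory.
Export numFieldNormedType.Exports.

Local Open Scope classical_set_scope.
Local Open Scope ring_scope.

(** * Weight functions

A weight function [0, oo) -> [0, oo) is encoded as a function [R -> R] of which
only the values on [0, oo) matter. *)

Section WeightFunctions.
Context {R : realType}.
Implicit Types (w : R -> R).

(* +oo packed as the [filter_on] that the Landau notations require *)
Definition at_pinfty : filter_on R := FilterType (pinfty_nbhs R) _.

Record weight_function w : Prop := {
  wf_ge0 : forall t : R, 0 <= t -> 0 <= w t;
  wf_continuous : {within `[0, +oo[, continuous w};
  (* "increasing" is non-strict, since w vanishes on [0, 1] *)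
  wf_increasing : forall s t : R, 0 <= s -> s <= t -> w s <= w t;
  wf_vanish : forall t : R, 0 <= t <= 1 -> w t = 0;
  wf_infty : w t @[t --> +oo] --> +oo;
  wf_log : (@ln R : R -> R) =o_ at_pinfty w;
  wf_convex : convex_function (setT : set R) (w \o expR);
  wf_omega1 : (fun t : R => w (2 * t)) =O_ at_pinfty w
}.

Definition omega2 w : Prop := w =O_ at_pinfty (fun t : R => t).

Definition omega5 w : Prop := w =o_ at_pinfty (fun t : R => t).

Definition omega6 w : Prop :=
  exists2 H : R, 1 <= H & forall t : R, 0 <= t -> 2 * w t <= w (H * t) + H.

Definition wf_equiv (u v : R -> R) : Prop :=
  u =O_ at_pinfty v /\ v =O_ at_pinfty u.

(* Young conjugate of y |-> w (e^y); the real supremum is a true one because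
   ln t = o(w t). *)
Definition phistar w (x : R) : R :=
  sup [set x * y - w (expR y) | y in `[0, +oo[].

Definition Omega w (l : R) (j : nat) : R := expR (l^-1 * phistar w (l * j%:R)).

End WeightFunctions.

(** * Weight sequences *)

Section WeightSequences.
Context {R : realType}.
Implicit Types (M N : nat -> R).

Record LC M : Prop := {
  LC_gt0 : forall k, 0 < M k;
  LC_0 : M 0%N = 1;
  LC_1 : 1 <= M 1%N;
  LC_logconvex : forall j, (1 <= j)%N -> M j ^+ 2 <= M j.-1 * M j.+1;
  LC_infty : (M k `^ (k%:R^-1)) @[k --> \oo] --> +oo
}.

Definition mg M : Prop :=
  exists2 C : R, 1 <= C & forall j k, M (j + k)%N <= C ^+ (j + k) * M j * M k.

Definition mu M (k : nat) : R := M k / M k.-1.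

Definition beta3 M : Prop :=
  exists2 Q : nat, (0 < Q)%N &
    (1 < limn_einf (fun p => (mu M (Q * p)%N / mu M p)%:E))%E.

Definition ws_le M N : Prop :=
  (ereal_sup [set ((M p / N p) `^ (p%:R^-1))%:E | p in [set p | (1 <= p)%N]]
   < +oo)%E.

Definition ws_equiv M N : Prop := ws_le M N /\ ws_le N M.

(* (M_p / p!)^(1/p) *)
Definition root_fact M (p : nat) : R := (M p / p`!%:R) `^ (p%:R^-1).

(* The real supremum is a true one as soon as M_p^(1/p) tends to +oo. *)
Definition omega_of M (t : R) : R :=
  if 0 < t then sup [set ln (t ^+ p / M p) | p in [set: nat]] else 0.

End WeightSequences.

(** * Ultradifferentiable classes *)

Section Classes.
Context {R : realType}.

Definition eucl_norm {n} (v : 'rV[R]_n) : R := Num.sqrt (\sum_(i < n) v 0 i ^+ 2).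

Section FixedDimensions.
Context {r s : nat}.
Implicit Types (f : 'rV[R]_r -> 'rV[R]_s) (U K : set 'rV[R]_r).

(* [frechet f [:: v1; ...; vk] x] is f^(k)(x)(v1, ..., vk): evaluation at
   (v2, ..., vk) is linear and continuous, hence commutes with the Frechet
   differential, so that
   f^(k)(x)(v1, ..., vk) = d(y |-> f^(k-1)(y)(v2, ..., vk))(x)(v1). *)
Fixpoint frechet f (vs : seq 'rV[R]_r) : 'rV[R]_r -> 'rV[R]_s :=
  if vs is v :: vs' then fun x => 'd (frechet f vs') x v else f.

(* As R^r is finite-dimensional, the map f^(k) into k-linear maps is
   differentiable iff all its evaluations are. *)
Definition smooth_on U f : Prop :=
  forall (vs : seq 'rV[R]_r) x, U x -> differentiable (frechet f vs) x.

Definition frechet_opnorm f (k : nat) (x : 'rV[R]_r) : \bar R :=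
  ereal_sup [set (eucl_norm (frechet f vs x))%:E |
    vs in [set vs | size vs = k /\ forall v, v \in vs -> eucl_norm v <= 1]].

Definition weighted_norm f K (W : nat -> R) : \bar R :=
  ereal_sup [set e | exists k x, K x /\
                     e = (frechet_opnorm f k x * ((W k)^-1)%:E)%E].

Definition norm_seq f (M : nat -> R) K (h : R) : \bar R :=
  weighted_norm f K (fun k => h ^+ k * M k).

Definition norm_fun f (w : R -> R) K (l : R) : \bar R :=
  weighted_norm f K (Omega w l).

End FixedDimensions.

Inductive class_type := Roumieu | Beurling.

Definition for_type (ty : class_type) (P : R -> Prop) : Prop :=
  match ty with
  | Roumieu => exists2 h, 0 < h & P h
  | Beurling => forall h, 0 < h -> P h
  end.

(* A class is a family of sets of functions R^r -> R^s indexed by r, s and U;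
   membership in the (U, r, s) component depends only on the restriction to the
   open set U. *)
Definition class := forall r s : nat, set 'rV[R]_r -> set ('rV[R]_r -> 'rV[R]_s).

Definition E_seq (ty : class_type) (M : nat -> R) : class :=
  fun r s U f => smooth_on U f /\
    forall K, compact K -> K `<=` U ->
      for_type ty (fun h => (norm_seq f M K h < +oo)%E).

Definition E_fun (ty : class_type) (w : R -> R) : class :=
  fun r s U f => smooth_on U f /\
    forall K, compact K -> K `<=` U ->
      for_type ty (fun l => (norm_fun f w K l < +oo)%E).

Definition class_eq (E E' : class) : Prop :=
  forall r s : nat, (0 < r)%N -> (0 < s)%N ->
  forall U : set 'rV[R]_r, open U -> U !=set0 -> E r s U = E' r s U.

End Classes.
Arguments class R : clear implicits.

(* Main.v *)
(** Idea. A function of the form [sum_m c_m (cos + sin) (nu_m t)] with [c_m, nu_m >= 0]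
    has derivatives at [0] of absolute value exactly [S_k = sum_m c_m nu_m ^ k], and
    everywhere at most [2 S_k]. For log-convex weights a gliding hump in the [nu_m]
    makes [S] violate any family of bounds that is not implied by the defining ones,
    so an inclusion of classes is a domination, up to factors [C ^ k], between weights
    (in one dimension, for both types, without functional analysis).

    Thus [E_[w] = E_[N]] squeezes [N] between [Omega w (2 l)] and [Omega w l] for some
    [l], which says that the Young conjugate satisfies
    [phi* (2 x) <= 2 phi* x + B x + B]. This doubling property is the conjugate form of
    (omega_6); it makes all the [Omega w l] equivalent to each other, hence to [N], and
    yields (mg), because convexity always gives
    [Omega w l (j + k) <= Omega w (2 l) j * Omega w (2 l) k].

    Conversely (mg) of [N] gives (omega_6), hence the doubling property, for [omega_N],
    and [N = Omega omega_N 1]. That [omega_N] is a weight function rests on (beta_3),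
    which implies (omega_1) for [omega_N]; under (mg) the converse implication holds
    too, whence (beta_3) for [Omega w l]. *)

Require Import Defs.
From mathcomp Require Import ring lra zify.

Set Implicit Arguments.
Unset Strict Implicit.
Unset Printing Implicit Defensive.

Local Open Scope classical_set_scope.
Local Open Scope ring_scope.

(** * Functions with prescribed moments *)

Section TrigSeries.
Context {R : realType}.
Implicit Types (t x y : R) (u v : nat -> R).

Lemma dominated_series u v : (forall m, `|u m| <= v m) -> cvgn (series v) ->
  cvgn (series u) /\ `|limn (series u)| <= limn (series v).
Proof.
move=> uv cv.
have cn : cvgn [normed series u].
  by apply: (series_le_cvg _ (fun n => le_trans (normr_ge0 _) (uv n)) uv cv) => n.
split; first exact: normed_cvg.
by apply: le_trans (lim_series_norm cn) _; apply: lim_series_le.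
Qed.

(** The signs run +, +, -, -, so that [trig k] is the [k]-th derivative of cos + sin. Unlike those
    of cos or sin alone, none of these derivatives vanishes at 0. *)
Definition trig_sign (k : nat) : R := (-1) ^+ k./2.

Definition trig (k : nat) t : R :=
  trig_sign k * cos t + trig_sign k.+1 * sin t.

Lemma is_derive_trig k t : is_derive t 1 (trig k) (trig k.+1 t).
Proof.
have h := is_deriveD (is_deriveZ (trig_sign k) (is_derive_cos t))
  (is_deriveZ (trig_sign k.+1) (is_derive_sin t)).
have -> : trig k = trig_sign k *: cos + trig_sign k.+1 *: sin by [].
apply: (is_derive_eq h); rewrite /trig /trig_sign /= exprS mulN1r /GRing.scale/=.
by ring.
Qed.

Lemma normr_trig_sign k : `|trig_sign k| = 1.
Proof. by rewrite normrX normrN1 expr1n. Qed.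

Lemma trig_bound k t : `|trig k t| <= 2.
Proof.
apply: le_trans (ler_normD _ _) _; rewrite !normrM !normr_trig_sign !mul1r.
by have := cos_max t; have := sin_max t; lra.
Qed.

Lemma trig_mvt k x y : exists2 z, `|z - x| <= `|y - x| &
  trig k y - trig k x = trig k.+1 z * (y - x).
Proof.
have mvt a b : a <= b -> exists2 z, z \in `[a, b] &
    trig k b - trig k a = trig k.+1 z * (b - a).
  move=> ab; apply: MVT_segment => // [z _|]; first exact: is_derive_trig.
  apply: continuous_subspaceT => z.
  by apply/differentiable_continuous/derivable1_diffP; case: (is_derive_trig k z).
have [xy|/ltW yx] := leP x y.
  have [z /[!in_itv]/= /andP[xz zy] e] := mvt _ _ xy.
  by exists z => //; rewrite !ger0_norm ?subr_ge0// lerB.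
have [z /[!in_itv]/= /andP[yz zx] e] := mvt _ _ yx; exists z.
  by rewrite !ler0_norm ?subr_le0// lerN2 lerB.
by rewrite -opprB e -mulrN opprB.
Qed.

(** Two uses of the mean value theorem give a remainder that is uniform in the base point and can
    therefore be summed over all frequencies. *)
Lemma trig_taylor k x y :
  `|trig k y - trig k x - trig k.+1 x * (y - x)| <= 2 * (y - x) ^+ 2.
Proof.
have [z zx ->] := trig_mvt k x y.
have [z' _ e] := trig_mvt k.+1 x z.
rewrite -mulrBl e -mulrA normrM ler_pM ?trig_bound// normrM.
by rewrite -(ger0_norm (sqr_ge0 (y - x))) normrX expr2 ler_wpM2r.
Qed.

Variables (c nu : nat -> R).
Hypotheses (c0 : forall m, 0 <= c m) (nu0 : forall m, 0 <= nu m).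

(** The [k]-th moment of the measure with mass [c m] at each [nu m]. *)
Definition moment (k : nat) : R := limn (series (fun m => c m * nu m ^+ k)).

Hypothesis summable : forall k, cvgn (series (fun m => c m * nu m ^+ k)).

(** The formal [k]-th termwise derivative of [trig_series 0]. *)
Definition trig_series (k : nat) t : R :=
  limn (series (fun m => c m * nu m ^+ k * trig k (nu m * t))).

Let coef_ge0 m k : 0 <= c m * nu m ^+ k.
Proof. by rewrite mulr_ge0// exprn_ge0. Qed.

Lemma is_cvg_moment2 k :
  cvgn (series (fun m => c m * nu m ^+ k * 2)) /\
  limn (series (fun m => c m * nu m ^+ k * 2)) = 2 * moment k.
Proof.
have -> : (fun m => c m * nu m ^+ k * 2) = 2 *: (fun m => c m * nu m ^+ k).
  by apply/funext => m /=; rewrite mulrC.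
split; first exact: is_cvg_seriesZ.
by rewrite lim_seriesZ.
Qed.

Lemma is_cvg_trig_series k t :
  cvgn (series (fun m => c m * nu m ^+ k * trig k (nu m * t))) /\
  `|trig_series k t| <= 2 * moment k.
Proof.
have [cv <-] := is_cvg_moment2 k.
apply: dominated_series => // m.
by rewrite normrM (ger0_norm (coef_ge0 m k)) ler_wpM2l// trig_bound.
Qed.

(** This sums [trig_taylor] over the rescaled frequencies; the square of [nu m * (y - x)] raises the
    order of the moment by two. *)
Lemma trig_series_taylor k x y :
  `|trig_series k y - trig_series k x - trig_series k.+1 x * (y - x)|
  <= 2 * moment k.+2 * (y - x) ^+ 2.
Proof.
have cY := (is_cvg_trig_series k y).1.
have cX := (is_cvg_trig_series k x).1.
have cX' := (is_cvg_trig_series k.+1 x).1.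
have cZ := @is_cvg_seriesZ _ _ (y - x) cX'.
rewrite mulrC -[(y - x) * _]/((y - x) *: trig_series k.+1 x).
rewrite /trig_series -(lim_seriesZ _ cX').
rewrite -(lim_seriesB cY cX) -lim_seriesB//; last exact: is_cvg_seriesB.
have [cv e] := is_cvg_moment2 k.+2.
rewrite -e mulrC -[_ * _]/((y - x) ^+ 2 *: _) -(lim_seriesZ _ cv).
set u := (X in `|limn (series X)|); set v := (X in _ <= limn (series X) :> R).
have cZv : cvgn (series v) := is_cvg_seriesZ cv.
apply: (fun h => (@dominated_series u v h cZv).2) => m.
have -> : u m = c m * nu m ^+ k * (trig k (nu m * y) - trig k (nu m * x)
      - trig k.+1 (nu m * x) * (nu m * y - nu m * x)).
  change (c m * nu m ^+ k * trig k (nu m * y) - c m * nu m ^+ k * trig k (nu m * x)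
    - (y - x) * (c m * nu m ^+ k.+1 * trig k.+1 (nu m * x)) =
    c m * nu m ^+ k * (trig k (nu m * y) - trig k (nu m * x)
      - trig k.+1 (nu m * x) * (nu m * y - nu m * x))).
  by rewrite exprS; ring.
rewrite normrM (ger0_norm (coef_ge0 m k)).
apply: le_trans (ler_wpM2l (coef_ge0 m k) (trig_taylor _ _ _)) _.
change (c m * nu m ^+ k * (2 * (nu m * y - nu m * x) ^+ 2) <=
  (y - x) ^+ 2 * (c m * nu m ^+ k.+2 * 2)).
by rewrite !exprS le_eqVlt; apply/orP; left; apply/eqP; ring.
Qed.

(** The quadratic remainder yields the derivative directly, without uniform convergence of the
    differentiated series. *)
Lemma is_derive_trig_series k t :
  is_derive t 1 (trig_series k) (trig_series k.+1 t).
Proof.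
set C := 2 * moment k.+2.
have C0 : 0 <= C.
  rewrite /C; have := (is_cvg_trig_series k.+2 t).2.
  exact: le_trans.
have lim_quot : h^-1 *: ((trig_series k \o shift t) (h *: (1 : R)) - trig_series k t)
    @[h --> 0^'] --> trig_series k.+1 t.
  apply/cvgrPdist_le => /= e e0; near=> h.
  have h0 : h != 0 by near: h; exact: nbhs_dnbhs_neq.
  (* [C] may be 0, hence the denominator [C + 1]. *)
  have hC : `|h| <= e / (C + 1).
    by near: h; apply: dnbhs0_le; rewrite divr_gt0// ltr_wpDl.
  have := trig_series_taylor k t (h + t).
  rewrite addrK [h *: 1]mulr1 => T.
  rewrite distrC.
  have -> : h^-1 *: (trig_series k (h + t) - trig_series k t) - trig_series k.+1 t
     = h^-1 * (trig_series k (h + t) - trig_series k t - trig_series k.+1 t * h).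
    by rewrite /GRing.scale/= [RHS]mulrBr mulrCA mulVf ?mulr1.
  rewrite normrM normfV ler_pdivrMl ?normr_gt0//; apply: le_trans T _.
  rewrite -(ger0_norm (sqr_ge0 h)) normrX expr2 mulrCA ler_wpM2l//.
  rewrite mulrC; apply: le_trans (ler_wpM2r C0 hC) _.
  by rewrite -mulrA ler_piMr ?(ltW e0)// mulrC ler_pdivrMr ?ltr_wpDl// mul1r lerDl.
by split; [apply/cvg_ex; eexists; exact: lim_quot|exact: cvg_lim lim_quot].
Unshelve. all: by end_near. Qed.

(** At 0 all terms carry the same sign [trig_sign k], so nothing cancels. *)
Lemma trig_series0 k : `|trig_series k 0| = moment k.
Proof.
have -> : trig_series k 0 = trig_sign k *: moment k.
  rewrite /moment -(lim_seriesZ _ (@summable k)) /trig_series; congr (limn (series _)).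
  apply/funext => m /=.
  by rewrite /trig mulr0 cos0 sin0 mulr1 mulr0 addr0 mulrC.
rewrite normrZ normr_trig_sign mul1r ger0_norm//.
rewrite /moment; apply: limr_ge; first exact: summable.
by apply: nearW => n; apply: sumr_ge0.
Qed.

Definition moment_function (x : 'rV[R]_1) : 'rV[R]_1 :=
  trig_series 0 (x 0 0) *: const_mx 1.

(** In one dimension each direction contributes a scalar factor. The closed form is stable under
    differentiation, so smoothness comes with it. *)
Lemma frechet_moment_function (vs : seq 'rV[R]_1) :
  frechet moment_function vs =
  (fun x : 'rV[R]_1 => ((\prod_(v <- vs) v 0 0) * trig_series (size vs) (x 0 0)) *: (const_mx 1 : 'rV[R]_1))
  /\ forall x : 'rV[R]_1, differentiable (frechet moment_function vs) x.
Proof.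
have dif k (a : R) (x : 'rV[R]_1) :
   is_diff x (fun x : 'rV[R]_1 => (a * trig_series k (x 0 0)) *: (const_mx 1 : 'rV[R]_1))
     (fun v : 'rV[R]_1 => (a * (v 0 0 * trig_series k.+1 (x 0 0))) *: (const_mx 1 : 'rV[R]_1)).
  have d1 : is_diff x (fun x : 'rV[R]_1 => x 0 0 : R) (fun x : 'rV[R]_1 => x 0 0 : R).
    have d0 := @differentiable_coord R 1 1 x 0 0.
    apply: DiffDef; first exact: d0.
    apply/funext => v; rewrite -deriveE//.
    apply: cvg_lim => //; apply: cvg_near_cst; near=> h.
    rewrite /= !mxE addrK scalerA mulVf ?scale1r//.
    by near: h; exact: nbhs_dnbhs_neq.
  have [dv de] := is_derive_trig_series k (x 0 0).
  have d2 : is_diff (x 0 0) (trig_series k) (fun h => h *: trig_series k.+1 (x 0 0)).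
    have dd : differentiable (trig_series k) (x 0 0) by exact/derivable1_diffP.
    apply: DiffDef => //.
    by rewrite diff1E// derive1E de.
  have d3 := is_diff_comp d1 d2.
  have d4 := is_diffZ a d3.
  have d5 := is_diff_comp d4 (is_diff_scalel _ (const_mx 1 : 'rV[R]_1)).
  exact: d5.
elim: vs => [|v vs [IH1 IH2]].
  split=> [|x]; last first.
    have -> : frechet moment_function [::] =
      (fun x : 'rV[R]_1 => (1 * trig_series 0 (x 0 0)) *: (const_mx 1 : 'rV[R]_1)).
      by apply/funext => y /=; rewrite mul1r.
    by case: (dif 0%N 1 x).
  by apply/funext => y /=; rewrite big_nil mul1r.
have E : frechet moment_function (v :: vs) =
  (fun x : 'rV[R]_1 => ((\prod_(v <- v :: vs) v 0 0) * trig_series (size vs).+1 (x 0 0)) *: (const_mx 1 : 'rV[R]_1)).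
  apply/funext => x /=; rewrite IH1.
  have [_ ->] := dif (size vs) (\prod_(v <- vs) v 0 0) x.
  by rewrite big_cons mulrA [_ * v 0 0]mulrC.
split => // x; rewrite E.
by case: (dif (size vs).+1 (\prod_(v <- v :: vs) v 0 0) x).
Unshelve. all: by end_near. Qed.
End TrigSeries.

(** * Domination of weights *)

Section SequenceComparison.
Context {R : realType}.
Implicit Types (M N : nat -> R).

Definition dom M N : Prop := exists2 C, 0 < C & forall k, M k <= C * N k.

(** The relation $M\preceq N$ without roots. Index 0 is included and forces [M 0 <= N 0]. *)
Definition gdom M N : Prop := exists2 C, 0 < C & forall k, M k <= C ^+ k * N k.

(** For positive sequences, a form of $M_k^{1/k}\to\infty$ without roots. *)
Definition fast_growing M : Prop := forall A, 0 < A -> dom (fun k => A ^+ k) M.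

(** The normalization in [LC] is left out, so that the notion is stable under multiplication by
    [h ^+ k]. *)
Record weight_sequence M : Prop := {
  ws_gt0 : forall k, 0 < M k;
  ws_logconvex : forall j, M j.+1 ^+ 2 <= M j * M j.+2;
  ws_growth : fast_growing M
}.

Lemma mu_gt0 M j : weight_sequence M -> 0 < mu M j.
Proof. by move=> wM; rewrite divr_gt0// (ws_gt0 wM). Qed.

Lemma mu_nondecreasing M i j : weight_sequence M -> (i <= j)%N ->
  mu M i.+1 <= mu M j.+1.
Proof.
move=> wM; elim: j => [|j IH]; first by rewrite leqn0 => /eqP ->.
rewrite leq_eqVlt => /predU1P[->//|]; rewrite ltnS => /IH /le_trans; apply.
rewrite /mu /= ler_pdivrMr ?ws_gt0// mulrAC ler_pdivlMr ?ws_gt0//.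
by rewrite -expr2 mulrC ws_logconvex.
Qed.

Lemma muK M j : weight_sequence M -> M j.+1 = M j * mu M j.+1.
Proof. by move=> wM; rewrite /mu /= mulrC divfK// gt_eqF// ws_gt0. Qed.

(* [k |-> M k] lies above the geometric progression that touches it at [j]
   and [j.+1]. *)
Lemma ws_tangent M j k : weight_sequence M ->
  M j.+1 * mu M j.+1 ^+ k <= M k * mu M j.+1 ^+ j.+1.
Proof.
move=> wM; set m := mu M j.+1.
have m0 : 0 < m by exact: mu_gt0.
have [jk|] := leqP j.+1 k.
  elim: k jk => [//|k IH]; rewrite leq_eqVlt => /predU1P[->//|].
  rewrite ltnS => jk; have {}IH := IH jk.
  rewrite (muK k wM) [m ^+ k.+1]exprSr mulrA.
  apply: le_trans (ler_wpM2r (ltW m0) IH) _.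
  rewrite mulrAC ler_wpM2r// ?exprn_ge0 ?(ltW m0)// ler_wpM2l ?(ltW (ws_gt0 wM _))//.
  by apply: mu_nondecreasing => //; exact: ltnW.
(* Below the point of contact, induct on the distance [j - k]. *)
rewrite ltnS => kj; rewrite -(subKn kj).
have : (j - k <= j)%N by rewrite leq_subr.
elim: (j - k)%N => [_|d IH dj].
  rewrite subn0 [in leLHS](muK j wM) -/m exprS.
  by rewrite mulrA.
rewrite -(ler_pM2r m0) -mulrA -exprSr -subSn// subSS.
apply: le_trans (IH (ltnW dj)) _.
rewrite mulrAC ler_wpM2r ?exprn_ge0 ?(ltW m0)//.
have -> : (j - d = (j - d.+1).+1)%N by rewrite -subSn.
rewrite (muK _ wM) ler_wpM2l ?(ltW (ws_gt0 wM _))//.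
by apply: mu_nondecreasing => //; rewrite leq_subr.
Qed.

Lemma weight_sequenceZ M (h : R) : 0 < h -> weight_sequence M ->
  weight_sequence (fun k => h ^+ k * M k).
Proof.
move=> h0 wM; split=> [k|j|A A0]; first by rewrite mulr_gt0 ?exprn_gt0// ws_gt0.
  rewrite exprMn -exprM [leRHS]mulrACA -exprD.
  rewrite (_ : j + j.+2 = j.+1 * 2)%N; last by rewrite muln2 -addnn addSnnS.
  by rewrite ler_wpM2l ?exprn_ge0 ?(ltW h0)// ws_logconvex.
have [C C0 CM] := ws_growth wM (divr_gt0 A0 h0).
exists C => // k; have := CM k.
by rewrite expr_div_n ler_pdivrMr ?exprn_gt0// -mulrA [M k * _]mulrC.
Qed.

Lemma dom_trans M N P : dom M N -> dom N P -> dom M P.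
Proof.
move=> [C C0 MN] [D D0 NP]; exists (C * D) => [|k]; first exact: mulr_gt0.
by apply: le_trans (MN k) _; rewrite -mulrA ler_wpM2l// ltW.
Qed.

Lemma gdom_trans M N P : gdom M N -> gdom N P -> gdom M P.
Proof.
move=> [C C0 MN] [D D0 NP]; exists (C * D) => [|k]; first exact: mulr_gt0.
by apply: le_trans (MN k) _; rewrite exprMn -mulrA ler_wpM2l// exprn_ge0// ltW.
Qed.

(* Gliding hump: the [m]-th exponential is tuned to an index where [A m] is
   much larger than [B m]. *)
Lemma gliding_hump (A B : nat -> nat -> R) :
  (forall m, weight_sequence (A m)) ->
  (forall m k, 0 < B m k) -> (forall m, A m 0%N <= B m 0%N) ->
  (forall m n k, (m <= n)%N -> A n k <= A m k) ->
  (forall m n k, (m <= n)%N -> B m k <= B n k) ->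
  (forall m, ~ gdom (A m) (B m)) ->
  exists c nu : nat -> R, [/\ forall m, 0 <= c m, forall m, 0 <= nu m,
    forall k, cvgn (series (fun m => c m * nu m ^+ k)),
    forall m, dom (moment c nu) (A m) & forall m, ~ dom (moment c nu) (B m)].
Proof.
move=> wA B0 AB0 Amon Bmon nAB.
(* If no such index existed, [2 ^+ m * m.+1%:R] would serve as the geometric constant for
   [gdom (A m) (B m)], index 0 being covered by [AB0]. *)
have /choice[j jP] m : exists j, m.+1%:R * B m j.+1 <= 2^-1 ^+ m * A m j.+1.
  apply: contrapT => /forallNP nj; apply: (nAB m).
  have C1 : 1 <= 2 ^+ m * m.+1%:R :> R.
    by rewrite -[leLHS]mulr1 ler_pM// ?exprn_ege1// ler1n.
  exists (2 ^+ m * m.+1%:R); first exact: lt_le_trans ltr01 C1.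
  case=> [|k]; first by rewrite mul1r.
  have /negP := nj k; rewrite -ltNge => /ltW.
  rewrite exprVn ler_pdivrMl ?exprn_gt0// mulrA => /le_trans; apply.
  by rewrite ler_wpM2r ?(ltW (B0 _ _))// exprS ler_peMr ?exprn_ege1// (le_trans ler01).
(* The progression [c m * nu m ^+ k] touches [2^-1 ^+ m * A m k] at [k = (j m).+1] and stays below
   it elsewhere, by [ws_tangent]. *)
pose nu m := mu (A m) (j m).+1.
pose c m := 2^-1 ^+ m * A m (j m).+1 / nu m ^+ (j m).+1.
have nu0 m : 0 < nu m by exact: mu_gt0.
have c0 m : 0 <= c m.
  by rewrite /c divr_ge0 ?mulr_ge0 ?exprn_ge0 ?invr_ge0 ?(ltW (ws_gt0 (wA m) _)) ?(ltW (nu0 m)).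
have cle m k : c m * nu m ^+ k <= 2^-1 ^+ m * A m k.
  rewrite /c mulrAC ler_pdivrMr ?exprn_gt0// -!mulrA ler_wpM2l ?exprn_ge0 ?invr_ge0//.
  exact: ws_tangent.
have geo C : cvgn (series (geometric C (2^-1 : R))).
  by apply: is_cvg_geometric_series; rewrite ger0_norm ?invr_ge0// invf_lt1// ltr1n.
have coef0 m k : 0 <= c m * nu m ^+ k by rewrite mulr_ge0// exprn_ge0// ltW.
have summ k : cvgn (series (fun m => c m * nu m ^+ k)).
  apply: (series_le_cvg _ _ _ (geo (A 0%N k))) => // m /=.
    by rewrite geometric_ge0// ?invr_ge0// (ltW (ws_gt0 (wA _) _)).
  apply: le_trans (cle m k) _; rewrite mulrC ler_wpM2r ?exprn_ge0 ?invr_ge0//.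
  exact: Amon.
exists c, nu; split => // [m|m|n [D D0 SD]]; first exact: ltW.
  (* Terms with [n >= m] are bounded through [Amon]. Each of the finitely many others is geometric
     in [k], hence dominated by [A m] by fast growth. *)
  have [C C0 CP] : exists2 C, 0 < C & forall n k, c n * nu n ^+ k <= C * 2^-1 ^+ n * A m k.
    suff [C C0 CP] : exists2 C, 0 < C & forall n k, (n < m)%N ->
        c n * nu n ^+ k <= C * 2^-1 ^+ n * A m k.
      exists (C + 1) => [|n k]; first by rewrite ltr_wpDr.
      have [mn|/(CP n k)] := leqP m n; last first.
        move=> /le_trans; apply; rewrite !ler_wpM2r ?exprn_ge0 ?invr_ge0//.
          exact: ltW (ws_gt0 (wA _) _).
        by rewrite lerDl.
      apply: le_trans (cle n k) _; rewrite ler_pM ?exprn_ge0 ?invr_ge0//.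
      - exact: ltW (ws_gt0 (wA _) _).
      - by rewrite ler_peMl ?exprn_ge0 ?invr_ge0// lerDr ltW.
      - exact: Amon.
    have : forall p, exists2 C, 0 < C & forall n k, (n < p)%N ->
        c n * nu n ^+ k <= C * 2^-1 ^+ n * A m k.
      elim=> [|p [C C0 IH]]; first by exists 1.
      have [E E0 EP] := ws_growth (wA m) (nu0 p).
      exists (C + c p * E * 2 ^+ p) => [|n k].
        apply: ltr_wpDr => //; apply: mulr_ge0; last exact: exprn_ge0.
        by apply: mulr_ge0 => //; exact: ltW.
      rewrite ltnS leq_eqVlt => /predU1P[->|/(IH n k) /le_trans]; last first.
        apply; rewrite !ler_wpM2r ?exprn_ge0 ?invr_ge0//.
          exact: ltW (ws_gt0 (wA _) _).
        rewrite lerDl; apply: mulr_ge0; last exact: exprn_ge0.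
        by apply: mulr_ge0 => //; exact: ltW.
      have := ler_wpM2l (c0 p) (EP k) => /le_trans; apply.
      rewrite mulrA ler_wpM2r ?(ltW (ws_gt0 (wA _) _))//.
      rewrite exprVn mulrDl mulfK ?expf_neq0//.
      by rewrite lerDr mulr_ge0 ?invr_ge0 ?exprn_ge0// ltW.
    exact.
  exists (2 * C) => [|k]; first exact: mulr_gt0.
  have -> : 2 * C * A m k = limn (series (geometric (C * A m k) (2^-1 : R))).
    have h : `|2^-1| < 1 :> R by rewrite ger0_norm ?invr_ge0// invf_lt1// ltr1n.
    rewrite (cvg_lim _ (@cvg_geometric_series R (C * A m k) _ h))//.
    have -> : 1 - 2^-1 = 2^-1 :> R by lra.
    by rewrite invrK; ring.
  apply: lim_series_le => // i.
  by apply: le_trans (CP i k) _; rewrite /geometric /= mulrAC.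
(* At the index [(j m).+1] the single term number [m] of the moment is already at least
   [m.+1 * B m], which exceeds [D * B n]. *)
have : exists m, (n <= m)%N /\ D < m.+1%:R.
  exists (maxn n (Num.truncn D)); rewrite leq_maxl; split => //.
  apply: lt_le_trans (_ : (Num.truncn D).+1%:R <= _).
    by have /andP[] := truncn_itv (ltW D0).
  by rewrite ler_nat ltnS leq_maxr.
move=> [m [nm Dm]].
have := jP m; apply/negP; rewrite -ltNge.
have -> : 2^-1 ^+ m * A m (j m).+1 = c m * nu m ^+ (j m).+1.
  by rewrite /c divfK// expf_neq0// gt_eqF.
apply: (@le_lt_trans _ _ (moment c nu (j m).+1)).
  pose u i := c i * nu i ^+ (j m).+1.
  have ndu : {homo series u : n m / (n <= m)%N >-> n <= m}.
    move=> p q pq; rewrite /series /= (big_cat_nat _ pq)//= lerDl sumr_ge0// => i _.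
    exact: coef0.
  have := nondecreasing_cvgn_le ndu (summ _) m.+1; apply: le_trans.
  by rewrite /series /= big_nat_recr//= lerDr sumr_ge0// => i _; exact: coef0.
apply: le_lt_trans (SD _) _.
apply: (@le_lt_trans _ _ (D * B m (j m).+1)).
  by rewrite ler_wpM2l ?(ltW D0)// Bmon.
by rewrite ltr_pM2r.
Qed.

End SequenceComparison.

(** * Inclusions between classes *)

Section Inclusions.
Context {R : realType}.
Implicit Types (M N W : nat -> R) (V : R -> nat -> R).

Lemma weighted_norm_finite r s (f : 'rV[R]_r -> 'rV[R]_s) K W :
  (forall k, 0 < W k) ->
  (weighted_norm f K W < +oo)%E <->
  exists2 C, 0 < C & forall x vs, K x -> (forall v, v \in vs -> eucl_norm v <= 1) ->
    eucl_norm (frechet f vs x) <= C * W (size vs).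
Proof.
move=> W0; split=> [fin|[C C0 CP]]; last first.
  apply: (@le_lt_trans _ _ C%:E); last exact: ltry.
  apply: ge_ereal_sup => _ [k [x [Kx ->]]].
  rewrite lee_pdivrMr//; apply: ge_ereal_sup => _ [vs [<- vs1] <-].
  by rewrite -EFinM lee_fin; exact: CP.
(* The supremum is [-oo] when [K] is empty; then [C = 1] will do. *)
have [C C0 CP] : exists2 C, 0 < C & (weighted_norm f K W <= C%:E)%E.
  case: (weighted_norm f K W) fin => [c| |]// _.
    exists (`|c| + 1); first by rewrite ltr_wpDl.
    by rewrite lee_fin (le_trans (ler_norm c))// lerDl.
  by exists 1; rewrite ?leNye.
exists C => // x vs Kx vs1; rewrite -lee_fin EFinM -lee_pdivrMr//.
apply: le_trans CP.
apply: le_trans (_ : (frechet_opnorm f (size vs) x * ((W (size vs))^-1)%:E <= _)%E).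
  rewrite lee_wpmul2r ?lee_fin ?invr_ge0 ?(ltW (W0 _))//.
  by apply: ereal_sup_ubound; exists vs.
by apply: ereal_sup_ubound; exists (size vs), x.
Qed.

(* Both [E_seq ty M] and [E_fun ty w] have this form, for
   [V h k = h ^+ k * M k] and [V = Omega w] respectively. *)
Definition E_family (ty : class_type) V : class R :=
  fun r s U f => smooth_on U f /\
    forall K, compact K -> K `<=` U ->
      for_type ty (fun h => (weighted_norm f K (V h) < +oo)%E).

(** The order of the quantifiers that corresponds to inclusion of the classes: parameters of the
    smaller class come first for Roumieu, those of the larger class for Beurling. *)
Definition family_le (ty : class_type) (rel : (nat -> R) -> (nat -> R) -> Prop) V V' :=
  match ty with
  | Roumieu => forall h, 0 < h -> exists2 h', 0 < h' & rel (V h) (V' h')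
  | Beurling => forall h', 0 < h' -> exists2 h, 0 < h & rel (V h) (V' h')
  end.

Lemma E_family_sub ty V V' r s (U : set 'rV[R]_r) :
  (forall h k, 0 < h -> 0 < V h k) -> (forall h k, 0 < h -> 0 < V' h k) ->
  family_le ty dom V V' -> @E_family ty V r s U `<=` @E_family ty V' r s U.
Proof.
move=> V0 V'0.
have step h h' f K : 0 < h -> 0 < h' -> dom (V h) (V' h') ->
    (@weighted_norm R r s f K (V h) < +oo)%E -> (@weighted_norm R r s f K (V' h') < +oo)%E.
  move=> h0 h'0 [C C0 CP].
  move=> /weighted_norm_finite[k|D D0 DP]; first exact: V0.
  apply/weighted_norm_finite => [k|]; first exact: V'0.
  exists (D * C) => [|x vs Kx vs1]; first exact: mulr_gt0.
  by apply: le_trans (DP _ _ Kx vs1) _; rewrite -mulrA ler_wpM2l// ltW.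
case: ty => VV' f [smf fK]; split=> // K cK KU.
  have [h h0 fh] := fK _ cK KU; have [h' h'0 hh'] := VV' _ h0.
  by exists h' => //; exact: step fh.
move=> h' h'0; have [h h0 hh'] := VV' _ h'0.
exact: step (fK _ cK KU _ h0).
Qed.

Lemma eucl_norm1 (v : 'rV[R]_1) : eucl_norm v = `|v 0 0|.
Proof. by rewrite /eucl_norm big_ord1 sqrtr_sqr. Qed.

Section MomentFunction.
Variables (c nu : nat -> R).
Hypotheses (c0 : forall m, 0 <= c m) (nu0 : forall m, 0 <= nu m).
Hypothesis summable : forall k, cvgn (series (fun m => c m * nu m ^+ k)).

Lemma moment_function_weighted_norm W K : (forall k, 0 < W k) ->
  dom (moment c nu) W -> (weighted_norm (moment_function c nu) K W < +oo)%E.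
Proof.
move=> W0 [C C0 CP]; apply/weighted_norm_finite => //.
exists (2 * C) => [|x vs _ vs1]; first exact: mulr_gt0.
have [-> _] := frechet_moment_function c0 nu0 summable vs.
rewrite eucl_norm1 !mxE mulr1 normrM.
apply: le_trans (_ : 1 * (2 * moment c nu (size vs)) <= _).
  rewrite ler_pM//; last exact: (is_cvg_trig_series _ _ _ _ _).2.
  elim: vs vs1 => [|v vs IH] vs1; first by rewrite big_nil normr1.
  rewrite big_cons normrM mulr_ile1 ?normr_ge0//.
    by rewrite -eucl_norm1 vs1// mem_head.
  by apply: IH => u uvs; apply: vs1; rewrite in_cons uvs orbT.
by rewrite mul1r -mulrA ler_wpM2l.
Qed.

(** Testing at the point 0 with all directions equal to 1 recovers the moments exactly, by
    [trig_series0]. *)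
Lemma weighted_norm_moment_function W : (forall k, 0 < W k) ->
  (weighted_norm (moment_function c nu) [set 0%R] W < +oo)%E -> dom (moment c nu) W.
Proof.
move=> W0 /weighted_norm_finite[//|C C0 CP]; exists C => // k.
have := CP 0 (nseq k (const_mx 1)) erefl; rewrite size_nseq.
have [-> _] := frechet_moment_function c0 nu0 summable (nseq k (const_mx 1)).
rewrite eucl_norm1 !mxE mulr1 normrM size_nseq trig_series0//.
rewrite big_nseq mxE iter_mulr_1 expr1n normr1 mul1r; apply=> v.
by rewrite mem_nseq => /andP[_ /eqP ->]; rewrite eucl_norm1 mxE normr1.
Qed.

Lemma moment_function_smooth : smooth_on [set: 'rV[R]_1] (moment_function c nu).
Proof. by move=> vs x _; have [_] := frechet_moment_function c0 nu0 summable vs. Qed.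

End MomentFunction.

(** A common frame for [h ^+ k * M k] and [Omega w]. Monotonicity in [h] lets sequences of
    parameters stand for all of them, and the value at index 0 provides the hypothesis [AB0] of the
    gliding hump. *)
Record weight_family V : Prop := {
  wfam_ws : forall h, 0 < h -> weight_sequence (V h);
  wfam_0 : forall h, 0 < h -> V h 0%N = 1;
  wfam_mono : forall h h' k, 0 < h -> h <= h' -> V h k <= V h' k
}.

Lemma dom_mono V h h' : weight_family V -> 0 < h -> h <= h' -> dom (V h) (V h').
Proof. by move=> wV h0 hh'; exists 1 => // k; rewrite mul1r; exact: wfam_mono. Qed.

(** By contraposition: if the relation between the weights fails, the gliding hump produces a moment
    function lying in the first class but not in the second. *)
Lemma sub_E_family ty V V' : weight_family V -> weight_family V' ->
  @E_family ty V 1 1 setT `<=` @E_family ty V' 1 1 setT -> family_le ty gdom V V'.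
Proof.
move=> wV wV' VV'.
have V0 h k : 0 < h -> 0 < V h k by move=> h0; exact: ws_gt0 (wfam_ws wV h0) k.
have V'0 h k : 0 < h -> 0 < V' h k by move=> h0; exact: ws_gt0 (wfam_ws wV' h0) k.
have K0 : [set (0 : 'rV[R]_1)] `<=` setT by [].
case: ty VV' => VV' h h0; apply: contrapT => /forallPNP nV.
  (* Roumieu: a single weight [V h] is played against the cofinal parameters [m.+1] of [V']. *)
  have [||//|//|||c [nu [c0 nu0 summ Sdom Sndom]]] :=
      @gliding_hump R (fun=> V h) (fun m => V' m.+1%:R).
  - by move=> m; exact: wfam_ws.
  - by move=> m k; exact: V'0.
  - by move=> m; rewrite !wfam_0.
  - by move=> m n k mn; apply: wfam_mono => //; rewrite ler_nat.
  - by move=> m; exact: nV.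
  have /VV'[_] : @E_family Roumieu V 1 1 setT (moment_function c nu).
    split=> [|K _ _]; first exact: moment_function_smooth.
    by exists h => //; apply: moment_function_weighted_norm => //; [move=> k; exact: V0|exact: Sdom 0%N].
  move=> /(_ _ (@compact_set1 _ _) K0)[h' h'0 /weighted_norm_moment_function].
  move=> /(_ c0 nu0 summ (fun k => V'0 _ k h'0)) Sh'.
  apply: (Sndom (Num.truncn h')); apply: dom_trans Sh' _.
  apply: dom_mono => //.
  by have /andP[_ /ltW] := truncn_itv (ltW h'0).
(* Beurling: the parameters [m.+1%:R^-1] of [V], which tend to 0, are played against a single weight
   [V' h]. *)
have [||||//||c [nu [c0 nu0 summ Sdom Sndom]]] :=
    @gliding_hump R (fun m => V m.+1%:R^-1) (fun=> V' h).
- by move=> m; apply: wfam_ws => //; rewrite invr_gt0.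
- by move=> m k; exact: V'0.
- by move=> m; rewrite !wfam_0.
- by move=> m n k mn; apply: wfam_mono => //; rewrite ?invr_gt0// lef_pV2 ?posrE// ler_nat.
- by move=> m; apply: nV; rewrite invr_gt0.
have /VV'[_] : @E_family Beurling V 1 1 setT (moment_function c nu).
  split=> [|K _ _ h' h'0]; first exact: moment_function_smooth.
  apply: moment_function_weighted_norm => //; first by move=> k; exact: V0.
  apply: dom_trans (Sdom (Num.truncn h'^-1)) _; apply: dom_mono; rewrite ?invr_gt0//.
  rewrite -[leRHS]invrK lef_pV2 ?posrE ?invr_gt0//.
  have hV : 0 < h'^-1 by rewrite invr_gt0.
  by have /andP[_ /ltW] := truncn_itv (ltW hV).
move=> /(_ _ (@compact_set1 _ _) K0 _ h0)/weighted_norm_moment_function.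
by move=> /(_ c0 nu0 summ (fun k => V'0 _ k h0)) => /(Sndom 0%N).
Qed.

End Inclusions.

(** * Associated functions *)

Section AffineDomination.
Context {R : realType}.
Implicit Types (u v w : R -> R).

(** A filter-free form of $u=O(v)$: the additive constant accounts for bounded arguments, so the
    inequality holds on all of $[0,\infty)$. *)
Definition affine_dom u v : Prop :=
  exists2 L, 0 < L & forall t, 0 <= t -> u t <= L * v t + L.

Lemma near_pinftyP (P : R -> Prop) :
  (\forall t \near +oo, P t) <-> exists2 T, 0 < T & forall t, T <= t -> P t.
Proof.
split=> [[T [_ TP]]|[T T0 TP]].
  exists (`|T| + 1) => [|t Tt]; first by rewrite ltr_wpDl.
  by apply: TP; apply: lt_le_trans Tt; rewrite (le_lt_trans (ler_norm T))// ltrDl.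
by exists T; split; [exact: num_real|move=> t /ltW; exact: TP].
Qed.

Lemma affine_dom_trans u v w : (forall t, 0 <= t -> 0 <= w t) ->
  affine_dom u v -> affine_dom v w -> affine_dom u w.
Proof.
move=> w0 [L L0 uv] [K K0 vw]; exists (L * K + L) => [|t t0].
  by rewrite addr_gt0// mulr_gt0.
have /(ler_wpM2l (ltW L0)) := vw _ t0; have := uv _ t0.
have : 0 <= L * w t by rewrite mulr_ge0 ?w0// ltW.
by lra.
Qed.

Lemma affine_dom_bigO u v : (forall t, 0 <= t -> 0 <= u t) ->
  v t @[t --> +oo] --> +oo -> affine_dom u v -> u =O_ at_pinfty v.
Proof.
move=> u0 /cvgryPge /(_ 1) v1 [L L0 uv]; apply/eqO_exP.
exists (L + L); first exact: addr_gt0.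
near=> t; have t0 : 0 <= t by near: t; exact: nbhs_pinfty_ge.
have vt1 : 1 <= v t by near: t.
rewrite ger0_norm ?u0// ger0_norm ?(le_trans ler01)//.
by apply: le_trans (uv _ t0) _; rewrite mulrDl lerD2l ler_peMr// ltW.
Unshelve. all: by end_near. Qed.

Lemma bigO_affine_dom u v : (forall s t, 0 <= s -> s <= t -> u s <= u t) ->
  (forall t, 0 <= t -> 0 <= v t) -> u =O_ at_pinfty v -> affine_dom u v.
Proof.
move=> umon v0 /eqO_exP[k k0 /near_pinftyP[T T0 uv]].
exists (k + `|u T|) => [|t t0]; first by rewrite ltr_wpDr.
have [Tt|tT] := leP T t.
  have := uv _ Tt; rewrite [`|v t|]ger0_norm ?v0//.
  move=> /(le_trans (ler_norm _)) /le_trans; apply.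
  rewrite mulrDl -addrA lerDl addr_ge0 ?mulr_ge0 ?v0//.
  by rewrite addr_ge0// ltW.
apply: le_trans (umon _ _ t0 (ltW tT)) _; apply: le_trans (ler_norm _) _.
by rewrite addrA lerDr addr_ge0 ?(ltW k0)// mulr_ge0 ?v0// addr_ge0// ltW.
Qed.

Lemma littleo_idP u : (forall t, 0 <= t -> 0 <= u t) ->
  (forall e, 0 < e -> exists2 C, 0 <= C & forall t, 0 <= t -> u t <= e * t + C) ->
  omega5 u.
Proof.
move=> u0 h; apply/eqoP => e e0.
have [C C0 uC] := h _ (divr_gt0 e0 (ltr0n R 2)).
apply/near_pinftyP; exists (C / (e / 2) + 1) => [|t Tt].
  by rewrite ltr_wpDl ?divr_ge0 ?divr_gt0// ltW.
have t0 : 0 <= t by rewrite (le_trans _ Tt)// addr_ge0// divr_ge0// ltW// divr_gt0.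
rewrite !ger0_norm ?u0//; apply: le_trans (uC _ t0) _.
have : C <= e / 2 * t.
  by rewrite mulrC -ler_pdivrMr ?divr_gt0// (le_trans _ Tt)// lerDl.
by lra.
Qed.

End AffineDomination.

(** * The associated function of a sequence as a weight function *)

Section AssociatedFunction.
Context {R : realType}.
Implicit Types (M N : nat -> R).

(** A root-free counterpart of [LC] that is also convenient for the sequences [Omega w l]. *)
Record normalized_ws M : Prop := {
  nws_ws : weight_sequence M;
  nws_0 : M 0%N = 1;
  nws_1 : 1 <= M 1%N
}.

Lemma mu_ge1 M j : normalized_ws M -> 1 <= mu M j.+1.
Proof.
move=> nM; apply: le_trans (mu_nondecreasing (nws_ws nM) (leq0n j)).
by rewrite /mu /= (nws_0 nM) divr1 (nws_1 nM).
Qed.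

Lemma nws_ge1 M k : normalized_ws M -> 1 <= M k.
Proof.
move=> nM; elim: k => [|k IH]; first by rewrite (nws_0 nM).
rewrite (muK k (nws_ws nM)) (le_trans IH)// ler_peMr ?mu_ge1//.
exact: le_trans IH.
Qed.

Lemma expr_unbounded (a C : R) : 1 < a -> exists P, forall p, (P <= p)%N -> C <= a ^+ p.
Proof.
move=> a1.
have [P HP] : exists P : nat, C <= a ^+ P.
  have b0 : 0 < a - 1 by rewrite subr_gt0.
  exists (Num.truncn (`|C| / (a - 1))).+1; apply: le_trans (ler_norm C) _.
  have C0 : 0 <= `|C| / (a - 1) by rewrite divr_ge0// ltW.
  have /andP[_ /ltW] := truncn_itv C0.
  set n := (Num.truncn _).+1; rewrite ler_pdivrMr// => /le_trans; apply.
  have bern m : m%:R * (a - 1) <= a ^+ m.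
    elim: m => [|m IH]; first by rewrite mul0r.
    rewrite exprS -natr1 mulrDl mul1r.
    have : 1 <= a ^+ m by rewrite exprn_ege1// ltW.
    have -> : a * a ^+ m = a ^+ m + (a - 1) * a ^+ m by ring.
    by move=> h; rewrite lerD// ler_peMr// ltW.
  exact: bern.
by exists P => p Pp; apply: le_trans HP _; rewrite ler_weXn2l// ltW.
Qed.

Lemma growth_near M : fast_growing M -> forall A : R, 0 < A ->
  exists P, forall p, (P <= p)%N -> A ^+ p <= M p.
Proof.
(* Growth is applied to [2 * A], and the surplus factor [2 ^+ p] absorbs [C]. *)
move=> gM A A0; have [C C0 CM] := gM _ (mulr_gt0 (ltr0n R 2) A0).
have [P HP] := expr_unbounded C (ltr1n R 2); exists P => p /HP C2.
have := CM p; rewrite exprMn => h.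
have Ap : 0 < A ^+ p by rewrite exprn_gt0.
rewrite -(ler_pM2l C0); apply: le_trans h; by rewrite ler_wpM2r ?(ltW Ap).
Qed.

Lemma near_growth M : (forall k, 0 < M k) ->
  (forall A : R, 0 < A -> exists P, forall p, (P <= p)%N -> A ^+ p <= M p) ->
  fast_growing M.
Proof.
move=> M0 h A A0; have [P HP] := h _ A0.
have S0 k : 0 <= A ^+ k / M k by rewrite divr_ge0 ?exprn_ge0// ltW.
exists (1 + \sum_(k < P) A ^+ k / M k) => [|k]; first by rewrite ltr_wpDr// sumr_ge0.
rewrite -ler_pdivrMr//; have [Pk|kP] := leqP P k.
  apply: le_trans (_ : 1 <= _); first by rewrite ler_pdivrMr// mul1r HP.
  by rewrite lerDl sumr_ge0.
rewrite (bigD1 (Ordinal kP))//= addrCA lerDl addr_ge0// sumr_ge0//.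
Qed.

Lemma LC_nws M : LC M -> normalized_ws M.
Proof.
move=> lM; split; [|exact: LC_0 lM|exact: LC_1 lM].
have M0 := LC_gt0 lM; split=> // [j|]; first exact: (LC_logconvex lM).
apply: near_growth => // A A0.
have /cvgryPge/(_ A)[P _ HP] := LC_infty lM; exists P.+1 => p Pp.
have := HP p (ltnW Pp); have p0 : p != 0%N by rewrite -lt0n (leq_ltn_trans _ Pp).
move=> h; have := ge0_ler_powR (ler0n R p) (ltW A0) (powR_ge0 _ _) h.
by rewrite -powRrM mulVf ?pnatr_eq0// powRr1 ?(ltW (M0 p))// powR_mulrn// ltW.
Qed.

(** Fast growth bounds the set in [omega_of], so that the real [sup] is a genuine supremum. *)
Lemma omega_of_ub M p t : weight_sequence M -> 0 < t ->
  p%:R * ln t - ln (M p) <= omega_of M t.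
Proof.
move=> wM t0; rewrite /omega_of t0.
have -> : p%:R * ln t - ln (M p) = ln (t ^+ p / M p).
  by rewrite ln_div ?posrE ?exprn_gt0 ?(ws_gt0 wM)// lnXn// mulr_natl.
apply: ub_le_sup; last by exists p.
have [C C0 CM] := ws_growth wM t0; exists (ln C) => _ [k _ <-].
rewrite ler_ln ?posrE// ?divr_gt0 ?exprn_gt0 ?(ws_gt0 wM)//.
by rewrite ler_pdivrMr ?(ws_gt0 wM).
Qed.

Lemma omega_of_le M t z : weight_sequence M -> 0 < t ->
  (forall p : nat, p%:R * ln t - ln (M p) <= z) -> omega_of M t <= z.
Proof.
move=> wM t0 h; rewrite /omega_of t0; apply: ge_sup.
  by exists (ln (t ^+ 0 / M 0%N)), 0%N.
move=> _ [p _ <-].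
by rewrite ln_div ?posrE ?exprn_gt0 ?(ws_gt0 wM)// lnXn// -mulr_natl.
Qed.

Lemma omega_of_ge0 M t : normalized_ws M -> 0 <= t -> 0 <= omega_of M t.
Proof.
move=> nM; rewrite le_eqVlt => /predU1P[<-|t0]; first by rewrite /omega_of ltxx.
apply: le_trans (omega_of_ub 0 (nws_ws nM) t0).
by rewrite (nws_0 nM) ln1 mul0r subr0.
Qed.

Lemma omega_of_increasing M s t : normalized_ws M -> 0 <= s -> s <= t ->
  omega_of M s <= omega_of M t.
Proof.
move=> nM; rewrite le_eqVlt => /predU1P[<- t0|s0 st].
  by rewrite {1}/omega_of ltxx omega_of_ge0.
have t0 := lt_le_trans s0 st.
apply: (omega_of_le (nws_ws nM)) => // p.
apply: le_trans (omega_of_ub p (nws_ws nM) t0).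
by rewrite lerD2r ler_wpM2l// ler_ln.
Qed.

Lemma omega_of_vanish M t : normalized_ws M -> 0 <= t <= 1 -> omega_of M t = 0.
Proof.
move=> nM /andP[t0 t1]; apply/eqP; rewrite eq_le omega_of_ge0// andbT.
move: t0; rewrite [0 <= t]le_eqVlt => /predU1P[<-|t0]; first by rewrite /omega_of ltxx.
apply: (omega_of_le (nws_ws nM)) => // p.
rewrite subr_le0 (@le_trans _ _ 0)//; last by rewrite ln_ge0// nws_ge1.
by rewrite mulr_ge0_le0// ln_le0.
Qed.

(** For [t <= T] the terms with [T ^+ p <= M p] are nonpositive, so only finitely many matter, and
    each is affine in [ln t] with slope below [P]. *)
Lemma omega_of_lipschitz M T : normalized_ws M -> 0 < T -> exists2 P, 0 <= P &
  forall s t, 0 < s -> s <= t -> t <= T ->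
    omega_of M t - omega_of M s <= P * (ln t - ln s).
Proof.
move=> nM T0; have wM := nws_ws nM.
have [P HP] := growth_near (ws_growth wM) T0.
exists P%:R => // s t s0 st tT; have t0 := lt_le_trans s0 st.
have lst : 0 <= ln t - ln s by rewrite subr_ge0 ler_ln.
rewrite lerBlDr; apply: (omega_of_le (nws_ws nM)) => // p.
have [Pp|pP] := leqP P p.
  apply: (@le_trans _ _ 0); last by rewrite addr_ge0 ?mulr_ge0 ?omega_of_ge0// ltW.
  rewrite subr_le0 mulr_natl -lnXn// ler_ln ?posrE ?exprn_gt0 ?(ws_gt0 wM)//.
  by apply: le_trans (HP _ Pp); rewrite lerXn2r ?nnegrE ?(ltW t0) ?(ltW T0).
have := omega_of_ub p wM s0.
have : p%:R * (ln t - ln s) <= P%:R * (ln t - ln s) by rewrite ler_wpM2r// ler_nat ltnW.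
rewrite mulrBr; lra.
Qed.

Lemma omega_of_continuous M : normalized_ws M ->
  {within `[0, +oo[, continuous (omega_of M)}.
Proof.
move=> nM; apply/continuous_within_itvcyP; split=> [t|].
  rewrite in_itv/= andbT => t0.
  have T0 : 0 < t + 1 by rewrite addr_gt0.
  have [P P0 HP] := omega_of_lipschitz nM T0.
  apply/cvgrPdist_le => /= e e0; near=> s.
  have s0 : 0 < s by near: s; exact: lt_nbhsr.
  have sT : s <= t + 1 by apply: ltW; near: s; apply: lt_nbhsl; rewrite ltrDl.
  have lip : `|omega_of M t - omega_of M s| <= P * `|ln t - ln s|.
    have [st|/ltW ts] := leP s t.
      rewrite ger0_norm ?subr_ge0 ?omega_of_increasing ?(ltW s0)//.
      rewrite ger0_norm ?subr_ge0 ?ler_ln//.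
      by apply: HP => //; rewrite lerDl.
    rewrite distrC ger0_norm ?subr_ge0 ?omega_of_increasing ?(ltW t0)//.
    by rewrite distrC ger0_norm ?subr_ge0 ?ler_ln//; exact: HP.
  apply: le_trans lip _.
  have : `|ln t - ln s| <= e / (P + 1).
    near: s; move/cvgrPdist_le: (continuous_ln t0); apply.
    by rewrite divr_gt0// ltr_wpDl.
  move=> /(ler_wpM2l P0) /le_trans; apply.
  by rewrite mulrCA ler_piMr ?(ltW e0)// ler_pdivrMr ?ltr_wpDl// mul1r lerDl.
rewrite omega_of_vanish ?lexx ?ler01//.
apply: cvg_near_cst; near=> t; apply: omega_of_vanish => //; apply/andP; split.
  by near: t; exact: nbhs_right_ge.
by near: t; exact: nbhs_right_le.
Unshelve. all: by end_near. Qed.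

(** In the variable $y=\ln t$ the function is a supremum of affine functions. *)
Lemma omega_of_convex M : normalized_ws M ->
  convex_function (setT : set R) (omega_of M \o expR).
Proof.
move=> nM t x y _ _; have wM := nws_ws nM.
rewrite [leRHS]convRE /= -[conv t x y]/(t%:num *: x + unstable.onem t%:num *: y).
apply: (omega_of_le wM); rewrite ?expR_gt0// => p.
rewrite expRK -![_ *: _]/(_ * _).
have := omega_of_ub p wM (expR_gt0 x); have := omega_of_ub p wM (expR_gt0 y).
rewrite !expRK /unstable.onem => hy hx.
have t0 : 0 <= t%:num by [].
have t1 : 0 <= 1 - t%:num by rewrite subr_ge0.
have := lerD (ler_wpM2l t0 hx) (ler_wpM2l t1 hy).
apply: le_trans; rewrite le_eqVlt; apply/orP; left; apply/eqP; ring.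
Qed.

Lemma omega_of_weight_function M : normalized_ws M ->
  affine_dom (fun t => omega_of M (2 * t)) (omega_of M) ->
  weight_function (omega_of M).
Proof.
move=> nM o1; have wM := nws_ws nM.
have infty : omega_of M t @[t --> +oo] --> +oo.
  apply/cvgryPge => A; apply/near_pinftyP.
  exists (expR (A + ln (M 1%N))) => [|t Tt]; first exact: expR_gt0.
  have t0 : 0 < t by rewrite (lt_le_trans _ Tt)// expR_gt0.
  apply: le_trans (omega_of_ub 1 wM t0).
  by rewrite mul1r lerBrDr -[leLHS]expRK ler_ln ?posrE ?expR_gt0.
split => //.
- by move=> t; exact: omega_of_ge0.
- exact: omega_of_continuous.
- by move=> s t; exact: omega_of_increasing.
- by move=> t; exact: omega_of_vanish.
(* In the term of index [p], one copy of [ln t] pays for [ln (M p)], and the remaining [p - 1]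
   copies exceed [e^-1 * ln t]. *)
- apply/eqoP => e e0; pose p := (Num.truncn e^-1).+2.
  have M0 := ws_gt0 wM p.
  apply/near_pinftyP; exists (1 + M p) => [|t Tt]; first exact: addr_gt0.
  have t1 : 1 <= t by rewrite (le_trans _ Tt)// lerDl ltW.
  have t0 : 0 < t by exact: lt_le_trans t1.
  rewrite ger0_norm ?ln_ge0// ger0_norm ?omega_of_ge0 ?(ltW t0)//.
  rewrite -ler_pdivrMl//; apply: le_trans (omega_of_ub p wM t0).
  have Mt : ln (M p) <= ln t.
    by rewrite ler_ln ?posrE// (le_trans _ Tt)// lerDr.
  suff : (e^-1 + 1) * ln t <= p%:R * ln t by lra.
  apply: ler_wpM2r; first exact: ln_ge0.
  have eV : 0 <= e^-1 by rewrite invr_ge0 ltW.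
  have /andP[_ /ltW] := truncn_itv eV.
  by rewrite /p -[in X in _ -> X]natr1 lerD2r.
- exact: omega_of_convex.
- apply: affine_dom_bigO => // t t0; apply: omega_of_ge0 => //.
  by rewrite mulr_ge0.
Qed.

(** By (mg), the [j]-th and [k]-th terms at [t] add up to at most the term of index [j + k] at
    [C * t]; then take suprema over [j] and [k] separately. *)
Lemma mg_omega6 M : normalized_ws M -> mg M -> omega6 (omega_of M).
Proof.
move=> nM [C C1 CM]; have wM := nws_ws nM; have C0 := lt_le_trans ltr01 C1.
exists C => // t; rewrite le_eqVlt => /predU1P[<-|t0].
  by rewrite mulr0 /omega_of ltxx mulr0 add0r ltW.
suff h j k : j%:R * ln t - ln (M j) + (k%:R * ln t - ln (M k)) <= omega_of M (C * t).
  apply: le_trans (_ : omega_of M (C * t) <= _); last by rewrite lerDl ltW.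
  rewrite mulr2n mulrDl mul1r -lerBrDr; apply: (omega_of_le wM) => // j.
  rewrite lerBrDr addrC -lerBrDr; apply: (omega_of_le wM) => // k.
  by rewrite lerBrDr.
apply: le_trans (omega_of_ub (j + k) wM (mulr_gt0 C0 t0)).
have : ln (M (j + k)%N) <= ln (C ^+ (j + k) * M j * M k).
  by rewrite ler_ln ?posrE ?mulr_gt0 ?exprn_gt0 ?(ws_gt0 wM).
rewrite !lnM ?posrE ?mulr_gt0 ?exprn_gt0 ?(ws_gt0 wM)// lnXn// -mulr_natl natrD.
by move=> h; nra.
Qed.

End AssociatedFunction.

(** * Young conjugates *)

Section YoungConjugate.
Context {R : realType}.
Variable w : R -> R.
Hypothesis ww : weight_function w.
Local Notation phi y := (w (expR y)).

Lemma phi_ge0 y : 0 <= phi y.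
Proof. by apply: (wf_ge0 ww); exact: expR_ge0. Qed.

Lemma phi0 : phi 0 = 0.
Proof. by rewrite expR0 (wf_vanish ww)// lexx ler01. Qed.

(** This is $\log t=o(\omega(t))$ in exponential coordinates; it makes the Young conjugate
    finite. *)
Lemma phi_superlinear (A : R) : exists2 C, 0 <= C & forall y, 0 <= y -> A * y <= phi y + C.
Proof.
have e0 : 0 < (`|A| + 1)^-1 by rewrite invr_gt0 ltr_wpDl.
have /eqoP/(_ _ e0)/near_pinftyP[T T0 TP] := wf_log ww.
exists (`|A| * T) => [|y y0]; first by rewrite mulr_ge0// ltW.
apply: le_trans (ler_wpM2r y0 (ler_norm A)) _.
have [Ty|/ltW yT] := leP T (expR y).
  have := TP _ Ty; rewrite expRK ger0_norm// [`|w _|]ger0_norm ?phi_ge0//.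
  rewrite ler_pdivlMl ?ltr_wpDl// => h.
  rewrite (@le_trans _ _ ((`|A| + 1) * y)) ?ler_wpM2r ?lerDl//.
  by rewrite (le_trans h)// lerDl mulr_ge0// ltW.
have yT' : y <= T by rewrite (le_trans _ yT)// (le_trans _ (expR_ge1Dx y))// lerDr.
by rewrite (@le_trans _ _ (`|A| * T))// ?ler_wpM2l// lerDr phi_ge0.
Qed.

Lemma phistar_ub x y : 0 <= y -> x * y - phi y <= phistar w x.
Proof.
move=> y0; apply: ub_le_sup; last by exists y => //=; rewrite in_itv/= y0.
have [C C0 CP] := phi_superlinear x; exists C => _ [z /= + <-].
by rewrite in_itv/= andbT => /CP ?; rewrite lerBlDl.
Qed.

Lemma phistar_le x z : (forall y, 0 <= y -> x * y - phi y <= z) -> phistar w x <= z.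
Proof.
move=> h; apply: ge_sup.
  by exists (x * 0 - phi 0), 0 => //=; rewrite in_itv/= lexx.
by move=> _ [y /= + <-]; rewrite in_itv/= andbT => /h.
Qed.

Lemma phistar_ge0 x : 0 <= phistar w x.
Proof. by apply: le_trans (phistar_ub x (lexx 0)); rewrite phi0 mulr0 subr0. Qed.

Lemma phistar0 : phistar w 0 = 0.
Proof.
apply/eqP; rewrite eq_le phistar_ge0 andbT; apply: phistar_le => y _.
by rewrite mul0r sub0r oppr_le0 phi_ge0.
Qed.

Lemma phistar_nondecreasing x x' : x <= x' -> phistar w x <= phistar w x'.
Proof.
move=> xx'; apply: phistar_le => y y0; apply: le_trans (phistar_ub x' y0).
by rewrite lerD2r ler_wpM2r.
Qed.

Lemma phistar_midpoint x y z : x + y = 2 * z ->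
  2 * phistar w z <= phistar w x + phistar w y.
Proof.
move=> xyz; rewrite mulrC -ler_pdivlMr//; apply: phistar_le => t t0.
rewrite ler_pdivlMr//; have := phistar_ub x t0; have := phistar_ub y t0.
have -> : (z * t - phi t) * 2 = (x * t - phi t) + (y * t - phi t).
  by rewrite -[x](addrK y) xyz; ring.
by lra.
Qed.

(** Dividing by the parameter scales the linear part of the conjugate back and shrinks the
    subtracted [phi], which is nonnegative. *)
Lemma phistar_star_shaped l l' x : 0 < l -> l <= l' ->
  l^-1 * phistar w (l * x) <= l'^-1 * phistar w (l' * x).
Proof.
move=> l0 ll'; have l'0 := lt_le_trans l0 ll'.
rewrite ler_pdivrMl// mulrA; apply: phistar_le => y y0.
rewrite -ler_pdivrMl ?divr_gt0// invf_div.
apply: le_trans (phistar_ub (l' * x) y0); rewrite mulrBr.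
have -> : l' / l * (l * x * y) = l' * x * y by field; rewrite gt_eqF.
by rewrite lerD2l lerN2 ler_peMl ?phi_ge0// ler_pdivlMr// mul1r.
Qed.

Lemma Omega_family : weight_family (Omega w).
Proof.
split=> [l l0|l _|l l' k l0 ll']; last first.
- by rewrite /Omega ler_expR phistar_star_shaped.
- by rewrite /Omega mulr0 phistar0 mulr0 expR0.
split=> [k|j|A A0]; first exact: expR_gt0.
  rewrite /Omega -expRM_natl -expRD ler_expR -mulrDr mulrCA ler_wpM2l ?invr_ge0 ?(ltW l0)//.
  apply: phistar_midpoint; rewrite -mulrDr mulrCA; congr (_ * _).
  by rewrite -!natr1; ring.
(* Evaluating the supremum in [phistar] at [y] gives a linear lower bound of slope at least [ln A]
   in [k]. *)
pose y := `|ln A|; exists (expR (l^-1 * phi y)) => [|k]; first exact: expR_gt0.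
rewrite -expRD -mulrDr -[A in A ^+ k]lnK ?posrE// -expRM_natl ler_expR.
rewrite ler_pdivlMl// -lerBlDl.
apply: le_trans (phistar_ub _ (normr_ge0 (ln A))).
by rewrite lerD2r mulrA ler_wpM2l ?ler_norm// mulr_ge0// ltW.
Qed.

Lemma Omega_nws l : 0 < l -> normalized_ws (Omega w l).
Proof.
move=> l0; split; [exact: wfam_ws Omega_family _ l0|exact: wfam_0 Omega_family _ l0|].
by rewrite /Omega -expR0 ler_expR mulr_ge0 ?phistar_ge0 ?invr_ge0 ?(ltW l0).
Qed.

(** In exponential coordinates (omega_1) bounds a shift of [phi] by [ln 2]. Conjugation turns the
    shift into the linear term [x * ln 2], that is, into the factor [2 ^+ k], and the multiple of
    [phi] into a dilation of the parameter. *)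
Lemma Omega_scale2 : exists2 L, 1 <= L & forall l, 0 < l ->
  dom (fun k => 2 ^+ k * Omega w l k) (Omega w (L * l)).
Proof.
have := wf_omega1 ww; move/bigO_affine_dom => [||L L0 h].
- move=> s t s0 st; apply: (wf_increasing ww); first by rewrite mulr_ge0.
  by rewrite ler_wpM2l.
- exact: wf_ge0 ww.
pose L' := L + 1; have L'1 : 1 <= L' by rewrite lerDr ltW.
have L'0 : 0 < L' := lt_le_trans ltr01 L'1.
have {}h y : phi (y + ln 2) <= L' * phi y + L'.
  have := h _ (expR_ge0 y).
  rewrite expRD lnK ?posrE// mulrC => /le_trans; apply.
  by rewrite lerD// ?lerDl// ler_wpM2r ?phi_ge0// lerDl.
(* The conjugate form of [h], later evaluated at [x = L' * l * k]. *)
have key x : L' * phistar w (x / L') + x * ln 2 <= phistar w x + L'.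
  rewrite -lerBrDr mulrC -ler_pdivlMr//; apply: phistar_le => y y0.
  rewrite ler_pdivlMr//.
  have y20 : 0 <= y + ln 2 by rewrite addr_ge0// ln_ge0// ler1n.
  have := phistar_ub x y20; have := h y.
  have -> : (x / L' * y - phi y) * L' = x * y - L' * phi y.
    by field; rewrite gt_eqF.
  by rewrite mulrDr; lra.
exists L' => // l l0; exists (expR (l^-1)) => [|k]; first exact: expR_gt0.
have -> : 2 ^+ k = expR (k%:R * ln 2) :> R by rewrite expRM_natl lnK ?posrE.
rewrite /Omega -!expRD ler_expR.
have L'l0 : 0 < L' * l by rewrite mulr_gt0.
have lV : 0 <= (L' * l)^-1 by rewrite invr_ge0 ltW.
have := ler_wpM2l lV (key (L' * l * k%:R)).
have -> : L' * l * k%:R / L' = l * k%:R by field; rewrite gt_eqF.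
set a := phistar w _; set b := phistar w _.
have -> : (L' * l)^-1 * (L' * a + L' * l * k%:R * ln 2) = k%:R * ln 2 + l^-1 * a.
  by field; rewrite !gt_eqF.
by have -> : (L' * l)^-1 * (b + L') = l^-1 + (L' * l)^-1 * b by field; rewrite !gt_eqF.
Qed.

Lemma Omega_scale (A : R) : exists2 L, 1 <= L & forall l, 0 < l ->
  dom (fun k => A ^+ k * Omega w l k) (Omega w (L * l)).
Proof.
have [L L1 HL] := Omega_scale2.
have {HL} pow2 n : exists2 L, 1 <= L & forall l, 0 < l ->
    dom (fun k => (2 ^+ n) ^+ k * Omega w l k) (Omega w (L * l)).
  elim: n => [|n [K K1 HK]].
    exists 1 => // l l0; exists 1 => // k; by rewrite expr0 expr1n !mul1r.
  exists (L * K) => [|l l0]; first by rewrite mulr_ege1.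
  have Kl : 0 < K * l by rewrite mulr_gt0// (lt_le_trans ltr01).
  rewrite -mulrA; apply: dom_trans (HL _ Kl).
  have [C C0 CP] := HK _ l0; exists C => // k.
  by rewrite exprS exprMn -mulrA [leRHS]mulrCA ler_wpM2l ?exprn_ge0.
have [P HP] := expr_unbounded `|A| (ltr1n R 2).
have [K K1 HK] := pow2 P; exists K => // l /HK [C C0 CP]; exists C => // k.
apply: le_trans (CP k); rewrite ler_wpM2r ?expR_ge0//.
by apply: le_trans (ler_norm _) _; rewrite normrX lerXn2r ?nnegrE ?exprn_ge0// HP.
Qed.

(** The slope is the supremum of the left difference quotients; it is nonnegative because [phi] is
    nondecreasing. *)
Lemma phi_supporting_line y : exists2 x, 0 <= x & forall z, phi y + x * (z - y) <= phi z.
Proof.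
(* The three-chord inequality with denominators cleared. *)
have cvx a b c : a < b -> b < c -> phi b * (c - a) <= phi a * (c - b) + phi c * (b - a).
  move=> ab bc; have ac : 0 < c - a by rewrite subr_gt0 (lt_trans ab).
  have t0 : 0 <= (c - b) / (c - a) by apply: divr_ge0; apply: ltW => //; rewrite subr_gt0.
  have t1 : (c - b) / (c - a) <= 1 by rewrite ler_pdivrMr// mul1r lerD2l lerN2 ltW.
  have := wf_convex ww (Itv01 t0 t1) (in_setT a) (in_setT c).
  rewrite [leRHS]convRE /=.
  rewrite -[conv _ _ _]/((c - b) / (c - a) *: a + unstable.onem ((c - b) / (c - a)) *: c).
  rewrite /unstable.onem -![_ *: _]/(_ * _).
  have -> : (c - b) / (c - a) * a + (1 - (c - b) / (c - a)) * c = b.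
    by field; rewrite gt_eqF.
  rewrite -(ler_pM2r ac) => /le_trans; apply.
  rewrite le_eqVlt; apply/orP; left; apply/eqP.
  by field; rewrite gt_eqF.
pose S := [set (phi y - phi z) / (y - z) | z in [set z | z < y]].
have ubS u : y < u -> ubound S ((phi u - phi y) / (u - y)).
  move=> yu _ [z /= zy <-].
  rewrite ler_pdivrMr ?subr_gt0// mulrAC ler_pdivlMr ?subr_gt0//.
  have := cvx _ _ _ zy yu; nra.
have yy1 : y - 1 < y by rewrite gtrBl.
have hS : has_ubound S by exists ((phi (y + 1) - phi y) / (y + 1 - y)); apply: ubS; rewrite ltrDl.
exists (sup S) => [|z].
  apply: le_trans (ub_le_sup hS (_ : S ((phi y - phi (y - 1)) / (y - (y - 1))))); last by exists (y - 1).
  rewrite divr_ge0// ?subr_ge0 ?(ltW yy1)//.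
  by apply: (wf_increasing ww); rewrite ?expR_ge0// ler_expR ltW.
have [zy|yz|->] := ltgtP z y; last by rewrite subrr mulr0 addr0.
  have := ub_le_sup hS (_ : S ((phi y - phi z) / (y - z))) => /(_ (ex_intro2 _ _ z zy erefl)).
  rewrite ler_pdivrMr ?subr_gt0//; nra.
have : sup S <= (phi z - phi y) / (z - y).
  apply: ge_sup; last exact: ubS.
  by exists ((phi y - phi (y - 1)) / (y - (y - 1))), (y - 1).
by rewrite ler_pdivlMr ?subr_gt0//; nra.
Qed.

(** The biconjugate recovers [phi], the optimal [x] being the slope of a supporting line at [y]. *)
Lemma phi_biconjugate y : exists2 x, 0 <= x & phi y <= x * y - phistar w x.
Proof.
have [x x0 h] := phi_supporting_line y; exists x => //.
rewrite lerBrDr addrC -lerBrDr; apply: phistar_le => z _.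
by have := h z; rewrite mulrBr; lra.
Qed.

Definition phistar_doubling : Prop :=
  exists2 B, 0 <= B & forall x, 0 <= x -> phistar w (2 * x) <= 2 * phistar w x + B * x + B.

Lemma phistar_doubling_omega6 : phistar_doubling -> omega6 w.
Proof.
(* Dilation by [expR B] shifts [ln t] by [B], a gain of [2 * x * B] that outweighs the error
   [B * x]; the summand [B] covers the additive constant. *)
move=> [B B0 HB]; exists (expR B + B) => [|t t0].
  rewrite -[1]addr0 lerD//.
  by rewrite -expR0 ler_expR.
have H0 : 0 <= expR B + B by rewrite addr_ge0// expR_ge0.
have [t1|/ltW t1] := leP t 1.
  rewrite (wf_vanish ww) ?t0// mulr0 addr_ge0//.
  by apply: (wf_ge0 ww); exact: mulr_ge0.
have t0' := lt_le_trans ltr01 t1.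
apply: le_trans (_ : phi (ln t + B) + B <= _); last first.
  rewrite lerD ?lerDr ?expR_ge0//.
  apply: (wf_increasing ww); first exact: expR_ge0.
  by rewrite expRD lnK ?posrE// mulrC ler_wpM2r// lerDl.
have [x x0] := phi_biconjugate (ln t); rewrite lnK ?posrE// => h.
have ltB : 0 <= ln t + B by rewrite addr_ge0// ln_ge0.
have := phistar_ub (2 * x) ltB; have := HB _ x0.
have : 0 <= B * x by rewrite mulr_ge0.
nra.
Qed.

(** For [y >= ln H], (omega_6) at [expR (y - ln H)] compares [phi y] with twice a shifted value; for
    smaller [y] the linear term alone is at most [2 * x * ln H]. *)
Lemma omega6_phistar_doubling : omega6 w -> phistar_doubling.
Proof.
move=> [H H1 h]; have H0 := lt_le_trans ltr01 H1.
have lH : 0 <= ln H by exact: ln_ge0.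
exists (2 * ln H + H) => [|x x0]; first by rewrite addr_ge0 ?mulr_ge0 ?(ltW H0).
apply: phistar_le => y y0.
have Hx : 0 <= H * x by rewrite mulr_ge0 ?(ltW H0).
have lHx : 0 <= ln H * x by rewrite mulr_ge0.
have [yH|/ltW Hy] := leP y (ln H).
  have : 2 * x * y <= 2 * x * ln H by rewrite ler_wpM2l// mulr_ge0.
  by have := phi_ge0 y; have := phistar_ge0 x; nra.
have yH0 : 0 <= y - ln H by rewrite subr_ge0.
have := phistar_ub x yH0; have := h _ (expR_ge0 (y - ln H)).
have -> : H * expR (y - ln H) = expR y.
  by rewrite -{1}[H]lnK ?posrE// -expRD addrCA subrr addr0.
by rewrite mulrBr; nra.
Qed.

(** The hypothesis is the doubling property on the lattice of multiples of [l]; monotonicity and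
    convexity extend it to all real [x]. *)
Lemma gdom_phistar_doubling l : 0 < l -> gdom (Omega w (2 * l)) (Omega w l) ->
  phistar_doubling.
Proof.
move=> l0 [C C0 CP]; pose B := 2 * l * `|ln C|.
have B0 : 0 <= B by rewrite !mulr_ge0// ltW.
have dbl j : phistar w (2 * (l * j%:R)) <= 2 * phistar w (l * j%:R) + B * j%:R.
  have := CP j; rewrite /Omega -[C in C ^+ j]lnK ?posrE// -expRM_natl -expRD ler_expR.
  rewrite -[2 * l * _]mulrA; set a := phistar w _; set b := phistar w _ => h.
  have l20 : 0 <= 2 * l by rewrite mulr_ge0// ltW.
  have := ler_wpM2l l20 h.
  have -> : 2 * l * ((2 * l)^-1 * a) = a by field; rewrite gt_eqF.
  have -> : 2 * l * (j%:R * ln C + l^-1 * b) = 2 * l * (j%:R * ln C) + 2 * b.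
    by field; rewrite gt_eqF.
  move=> /le_trans; apply; rewrite addrC lerD2l /B -!mulrA.
  rewrite ler_wpM2l// ler_wpM2l ?(ltW l0)//.
  by rewrite mulrC ler_wpM2r// ler_norm.
exists (2 * B / l + 2 * B + phistar w (2 * l)) => [|x x0].
  by rewrite !addr_ge0 ?phistar_ge0 ?divr_ge0 ?mulr_ge0// ltW.
have xl0 : 0 <= x / l by rewrite divr_ge0// ltW.
set i := Num.truncn (x / l).
have /andP[ix xi] := truncn_itv xl0; rewrite -/i in ix xi.
have {}ix : l * i%:R <= x by rewrite mulrC -ler_pdivlMr.
have {}xi : x <= l * i.+1%:R by rewrite mulrC -ler_pdivrMr// ltW.
have h1 : phistar w (2 * x) <= phistar w (2 * (l * i.+1%:R)).
  by apply: phistar_nondecreasing; rewrite ler_wpM2l.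
have h2 := dbl i.+1; have h3 := dbl i.
(* [l * i.+1] is the midpoint of [2 * l * i] and [2 * l], which leads back from [i.+1] to [i], below
   [x / l]. *)
have h4 : 2 * phistar w (l * i.+1%:R) <= phistar w (2 * (l * i%:R)) + phistar w (2 * l).
  by apply: phistar_midpoint; rewrite -natr1; ring.
have h5 : phistar w (l * i%:R) <= phistar w x by exact: phistar_nondecreasing.
have h6 : B * i%:R <= B / l * x.
  by rewrite -mulrA ler_wpM2l// mulrC ler_pdivlMr// mulrC.
have h7 : 0 <= B / l by rewrite divr_ge0// ltW.
have h8 : 0 <= phistar w (2 * l) * x by rewrite mulr_ge0 ?phistar_ge0.
have h9 : 0 <= B * x by rewrite mulr_ge0.
rewrite -natr1 in h2; nra.
Qed.

Lemma phistar_doubling_gdom l l' : phistar_doubling -> 0 < l -> 0 < l' ->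
  gdom (Omega w l) (Omega w l').
Proof.
move=> [B B0 HB] l0 l'0.
have dbl k : 0 < k -> gdom (Omega w (2 * k)) (Omega w k).
  move=> k0; exists (expR (B / 2 + (2 * k)^-1 * B)) => [|j]; first exact: expR_gt0.
  (* A geometric constant cannot absorb [B] at index 0, where both sides equal 1; from index 1 on,
     [B <= B * j.+1]. *)
  case: j => [|j]; first by rewrite !(wfam_0 Omega_family) ?mulr_gt0// mul1r.
  rewrite /Omega -expRM_natl -expRD ler_expR ler_pdivrMl ?mulr_gt0//.
  have kj0 : 0 <= k * j.+1%:R by rewrite mulr_ge0// ltW.
  rewrite -[2 * k * j.+1%:R]mulrA; apply: le_trans (HB _ kj0) _.
  set a := phistar w _.
  have -> : 2 * k * (j.+1%:R * (B / 2 + (2 * k)^-1 * B) + k^-1 * a) =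
      2 * a + B * (k * j.+1%:R) + B * j.+1%:R.
    by field; rewrite gt_eqF.
  by rewrite lerD2l ler_peMr// ler1n.
have dbln n : gdom (Omega w (2 ^+ n * l')) (Omega w l').
  elim: n => [|n IH]; first by exists 1 => // k; rewrite expr0 expr1n !mul1r.
  by apply: gdom_trans IH; rewrite exprS -mulrA; apply: dbl; rewrite mulr_gt0 ?exprn_gt0.
have [P HP] := expr_unbounded (l / l') (ltr1n R 2).
apply: gdom_trans (dbln P); exists 1 => // k; rewrite expr1n mul1r.
by apply: (wfam_mono Omega_family); rewrite // -ler_pdivrMr// HP.
Qed.

Lemma Omega_mg l : phistar_doubling -> 0 < l -> mg (Omega w l).
Proof.
move=> dbl l0; have l20 : 0 < 2 * l by rewrite mulr_gt0.
have [C C0 CP] := phistar_doubling_gdom dbl l20 l0.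
exists (C + 1) => [|j k]; first by rewrite lerDr ltW.
(* [l * (j + k)] is the midpoint of [2 * l * j] and [2 * l * k]. *)
have : Omega w l (j + k) <= Omega w (2 * l) j * Omega w (2 * l) k.
  rewrite /Omega -expRD ler_expR -mulrDr ler_pdivlMl ?mulr_gt0//.
  rewrite -mulrA mulVKf ?gt_eqF//; apply: phistar_midpoint.
  by rewrite natrD; ring.
move=> /le_trans; apply.
apply: le_trans (ler_pM _ _ (CP j) (CP k)) _; rewrite ?expR_ge0//.
rewrite mulrACA -exprD -mulrA ler_wpM2r ?mulr_ge0 ?expR_ge0//.
by rewrite lerXn2r ?nnegrE ?addr_ge0 ?(ltW C0)// lerDl.
Qed.

(** The left side is a biconjugate in which only the slopes in the lattice of multiples of [l] are
    tried. *)
Lemma omega_Omega_le l t : 0 < l -> 0 <= t -> omega_of (Omega w l) t <= l^-1 * w t.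
Proof.
move=> l0; rewrite le_eqVlt => /predU1P[<-|t0].
  by rewrite /omega_of ltxx (wf_vanish ww) ?lexx ?ler01// mulr0.
have nO := Omega_nws l0; have [t1|/ltW t1] := leP t 1.
  by rewrite (omega_of_vanish nO) ?(ltW t0)// mulr_ge0 ?invr_ge0 ?(ltW l0) ?(wf_ge0 ww) ?(ltW t0).
apply: (omega_of_le (nws_ws nO)) => // p.
rewrite /Omega expRK ler_pdivlMl// mulrBr mulVKf ?gt_eqF//.
have := phistar_ub (l * p%:R) (ln_ge0 t1); rewrite lnK ?posrE//.
by rewrite mulrA; lra.
Qed.

(** Rounding the optimal slope down to a multiple of [l] loses at most one lattice step, which costs
    [ln t] after division by [l]. *)
Lemma le_omega_Omega l t : 0 < l -> 1 <= t ->
  l^-1 * w t <= omega_of (Omega w l) t + ln t.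
Proof.
move=> l0 t1; have t0 := lt_le_trans ltr01 t1.
have nO := Omega_nws l0.
have [x x0] := phi_biconjugate (ln t); rewrite lnK ?posrE// => h.
have xl0 : 0 <= x / l by rewrite divr_ge0// ltW.
have /andP[ix /ltW xi] := truncn_itv xl0; set i := Num.truncn (x / l) in ix xi.
have {}ix : l * i%:R <= x by rewrite mulrC -ler_pdivlMr.
have := omega_of_ub i (nws_ws nO) t0; rewrite /Omega expRK => h2.
have h3 : phistar w (l * i%:R) <= phistar w x by exact: phistar_nondecreasing.
have h4 : x / l * ln t <= i.+1%:R * ln t by rewrite ler_wpM2r// ln_ge0.
have lV : 0 <= l^-1 by rewrite invr_ge0 ltW.
have := ler_wpM2l lV h; have := ler_wpM2l lV h3; rewrite -natr1 in h4.
by rewrite mulrBr; nra.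
Qed.

End YoungConjugate.

(** * Comparison of sequences and weight functions *)

Section LimitInferior.
Context {R : realType}.
Implicit Types (u : nat -> R).

Lemma limn_einf_ge u (a : R) : (\forall p \near \oo, a <= u p) ->
  (a%:E <= limn_einf (fun p => (u p)%:E))%E.
Proof.
move=> [P _ HP]; rewrite limn_einf_lim (cvg_lim _ (@cvg_einfs_sup _ _))//.
apply: le_trans (_ : (einfs (fun p => (u p)%:E) P <= _)%E).
  by apply: le_ereal_inf_tmp => _ [p /= Pp <-]; rewrite lee_fin; exact: HP.
by apply: ereal_sup_ubound; exists P.
Qed.

Lemma limn_einf_gt u (a : R) : (a%:E < limn_einf (fun p => (u p)%:E))%E ->
  exists2 b, a < b & \forall p \near \oo, b <= u p.
Proof.
rewrite limn_einf_lim (cvg_lim _ (@cvg_einfs_sup _ _))// => /ereal_sup_gt[_ [P _ <-]] aP.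
have le_u p : (P <= p)%N -> (einfs (fun p => (u p)%:E) P <= (u p)%:E)%E.
  by move=> Pp; apply: ereal_inf_lbound; exists p.
case: (einfs _ P) aP le_u => [b| |]// aP le_u; last by have := le_u P (leqnn P).
by exists b; [rewrite -lte_fin|exists P => // p Pp; rewrite -lee_fin; exact: le_u].
Qed.

End LimitInferior.

(** * Equivalent weights and equality of classes *)

Section Equivalences.
Context {R : realType}.
Implicit Types (M N : nat -> R) (w : R -> R) (V : R -> nat -> R).

Lemma gdom_ws_le M N : (forall k, 0 < M k) -> (forall k, 0 < N k) ->
  gdom M N -> ws_le M N.
Proof.
move=> M0 N0 [C C0 CP]; apply: (@le_lt_trans _ _ C%:E); last exact: ltry.
apply: ge_ereal_sup => _ [p /= p1 <-]; rewrite lee_fin.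
have p0 : p%:R != 0 :> R by rewrite pnatr_eq0 -lt0n.
have -> : C = (C ^+ p) `^ p%:R^-1.
  by rewrite -powR_mulrn ?(ltW C0)// -powRrM mulfV// powRr1// ltW.
apply: ge0_ler_powR; rewrite ?nnegrE ?invr_ge0 ?exprn_ge0 ?divr_ge0 ?(ltW C0)//.
- exact: ltW.
- exact: ltW.
by rewrite ler_pdivrMr.
Qed.

Lemma gdomZl (h : R) M N : 0 < h -> gdom (fun k => h ^+ k * M k) N -> gdom M N.
Proof.
move=> h0 [C C0 CP]; exists (C / h) => [|k]; first exact: divr_gt0.
have := CP k; rewrite expr_div_n mulrAC ler_pdivlMr ?exprn_gt0//.
by rewrite mulrC.
Qed.

Lemma gdomZr (h : R) M N : 0 < h -> gdom M (fun k => h ^+ k * N k) -> gdom M N.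
Proof.
move=> h0 [C C0 CP]; exists (C * h) => [|k]; first exact: mulr_gt0.
by have := CP k; rewrite exprMn mulrA.
Qed.

Lemma mg_gdom M N : (forall k, 0 < M k) -> (forall k, 0 < N k) ->
  gdom M N -> gdom N M -> mg N -> mg M.
Proof.
move=> M0 N0 [C C0 MN] [D D0 NM] [E E1 EN].
have E0 : 0 < E := lt_le_trans ltr01 E1.
exists (1 + C * E * D) => [|j k]; first by rewrite lerDl !mulr_ge0// ltW.
apply: le_trans (MN _) _.
apply: le_trans (ler_wpM2l (exprn_ge0 _ (ltW C0)) (EN j k)) _.
have hj : 0 <= N j by exact: ltW. have hk : 0 <= N k by exact: ltW.
apply: le_trans (_ : C ^+ (j + k) * (E ^+ (j + k) * (D ^+ j * M j) * (D ^+ k * M k)) <= _).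
  rewrite ler_wpM2l ?exprn_ge0 ?(ltW C0)//.
  by rewrite ler_pM ?mulr_ge0 ?exprn_ge0 ?(ltW E0)// ler_wpM2l ?exprn_ge0 ?(ltW E0).
apply: le_trans (_ : (C * E * D) ^+ (j + k) * M j * M k <= _).
  rewrite !exprMn [D ^+ (j + k)]exprD le_eqVlt; apply/orP; left; apply/eqP; ring.
rewrite !ler_wpM2r ?(ltW (M0 _))//.
by rewrite lerXn2r ?nnegrE ?addr_ge0 ?mulr_ge0 ?(ltW C0) ?(ltW E0) ?(ltW D0)// lerDr.
Qed.

Lemma seq_family N : normalized_ws N -> weight_family (fun h k => h ^+ k * N k).
Proof.
move=> nN; split=> [h h0|h _|h h' k h0 hh'].
- exact: weight_sequenceZ h0 (nws_ws nN).
- by rewrite mul1r (nws_0 nN).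
- rewrite ler_wpM2r ?(ltW (ws_gt0 (nws_ws nN) k))//.
  by rewrite lerXn2r ?nnegrE ?(ltW h0) ?(le_trans (ltW h0)).
Qed.

Lemma class_eq_family ty V V' : weight_family V -> weight_family V' ->
  family_le ty dom V V' -> family_le ty dom V' V ->
  class_eq (E_family ty V) (E_family ty V').
Proof.
move=> wV wV' VV' V'V r s _ _ U _ _; rewrite eqEsubset.
by split; apply: E_family_sub => // h k h0; apply: ws_gt0; apply: wfam_ws.
Qed.

Lemma gdom_family_le ty M N : gdom M N ->
  family_le ty dom (fun h k => h ^+ k * M k) (fun h k => h ^+ k * N k).
Proof.
move=> [C C0 CP]; case: ty => h h0.
  exists (h * C); first exact: mulr_gt0.
  exists 1 => // k; rewrite mul1r exprMn -mulrA ler_wpM2l ?exprn_ge0//.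
  exact: ltW.
exists (h / C); first exact: divr_gt0.
exists 1 => // k; rewrite mul1r expr_div_n -mulrA ler_wpM2l ?exprn_ge0 ?(ltW h0)//.
by rewrite ler_pdivrMl ?exprn_gt0.
Qed.

Lemma E_seq_equiv ty M N : normalized_ws M -> normalized_ws N ->
  gdom M N -> gdom N M -> class_eq (E_seq ty M) (E_seq ty N).
Proof.
move=> nM nN MN NM.
by apply: (class_eq_family (seq_family nM) (seq_family nN)); exact: gdom_family_le.
Qed.

(** Two of the four comparisons hold with the geometric constant as parameter. In the other two the
    factor is prescribed, and [Omega_scale], hence (omega_1), absorbs it. *)
Lemma E_fun_seq ty w N : weight_function w -> normalized_ws N ->
  (forall l, 0 < l -> gdom N (Omega w l)) -> (forall l, 0 < l -> gdom (Omega w l) N) ->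
  class_eq (E_fun ty w) (E_seq ty N).
Proof.
move=> ww nN NO ON.
have l1 : 0 < 1 :> R by [].
have [C C0 CP] := ON _ l1; have [D D0 DP] := NO _ l1.
apply: (class_eq_family (Omega_family ww) (seq_family nN)).
  case: ty => h h0.
    have [E E0 EP] := ON _ h0; exists E => //.
    by exists 1 => // k; rewrite mul1r.
  have [L L1 HL] := Omega_scale ww (C / h).
  have L0 : 0 < L := lt_le_trans ltr01 L1.
  have LV : 0 < L^-1 by rewrite invr_gt0.
  exists L^-1 => //; have [E E0 EP] := HL _ LV.
  exists E => // k; have := EP k; rewrite mulfV ?gt_eqF//.
  rewrite expr_div_n mulrAC ler_pdivrMr ?exprn_gt0// => h1.
  have Ck : 0 < C ^+ k by rewrite exprn_gt0.
  rewrite -(ler_pM2l Ck); apply: le_trans h1 _.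
  have -> : C ^+ k * (E * (h ^+ k * N k)) = E * (C ^+ k * N k) * h ^+ k by ring.
  by rewrite ler_wpM2r ?exprn_ge0 ?(ltW h0)// ler_wpM2l// ltW.
case: ty => h h0.
  have [L L1 HL] := Omega_scale ww (h * D).
  exists (L * 1); first by rewrite mulr1 (lt_le_trans ltr01).
  have [E E0 EP] := HL _ l1; exists E => // k.
  apply: le_trans (EP k); rewrite exprMn -mulrA ler_wpM2l ?exprn_ge0//.
  exact: ltW.
have [E E0 EP] := NO _ h0; exists E^-1; first by rewrite invr_gt0.
by exists 1 => // k; rewrite mul1r exprVn ler_pdivrMl ?exprn_gt0.
Qed.

(** Only real functions on the line are needed. Roumieu first finds [l] above [N] and then bounds
    the weight with parameter [2 * l]; Beurling first finds the weight below [N] and then halves its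
    parameter. *)
Lemma class_eq_gdom ty w N : weight_function w -> normalized_ws N ->
  class_eq (E_fun ty w) (E_seq ty N) ->
  exists2 l, 0 < l & gdom (Omega w (2 * l)) N /\ gdom N (Omega w l).
Proof.
move=> ww nN /(_ 1%N 1%N isT isT setT openT (ex_intro _ 0 I)) e.
have wO := Omega_family ww; have wN := seq_family nN.
have ON : family_le ty gdom (Omega w) (fun h k => h ^+ k * N k).
  apply: sub_E_family => //.
  by change (@E_fun R ty w 1 1 setT `<=` @E_seq R ty N 1 1 setT); rewrite e.
have NO : family_le ty gdom (fun h k => h ^+ k * N k) (Omega w).
  apply: sub_E_family => //.
  by change (@E_seq R ty N 1 1 setT `<=` @E_fun R ty w 1 1 setT); rewrite e.
have l1 : 0 < 1 :> R by [].
case: ty e ON NO => e ON NO.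
  have [l l0 Nl] := NO _ l1; exists l => //; split; last exact: gdomZl Nl.
  have l20 : 0 < 2 * l by rewrite mulr_gt0.
  have [h h0 lN] := ON _ l20; exact: gdomZr lN.
have [l l0 lN] := ON _ l1; exists (l / 2); first exact: divr_gt0.
rewrite mulrCA mulfV ?mulr1//; split; first exact: gdomZr lN.
have l20 : 0 < l / 2 by rewrite divr_gt0.
have [h h0 Nl] := NO _ l20; exact: gdomZl Nl.
Qed.

End Equivalences.

(** * The associated function in terms of quotients and factorials *)

Section AssociatedFunctionGrowth.
Context {R : realType}.
Implicit Types (M N : nat -> R).

Lemma ln_mulX (x y : R) n : 0 < x -> 0 < y -> ln (x * y ^+ n) = ln x + n%:R * ln y.
Proof.
by move=> x0 y0; rewrite lnM ?posrE ?exprn_gt0// lnXn// mulr_natl.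
Qed.

Lemma ln_mul2 (x : R) : 0 < x -> ln (2 * x) = ln 2 + ln x.
Proof. by move=> x0; rewrite lnM ?posrE. Qed.

Lemma ln_mu M j : weight_sequence M -> ln (M j.+1) = ln (M j) + ln (mu M j.+1).
Proof. by move=> wM; rewrite (muK j wM) lnM ?posrE ?mu_gt0 ?(ws_gt0 wM). Qed.

(** At [t = mu M j.+1] the supremum is attained at the index [j.+1], by [ws_tangent]. *)
Lemma omega_of_mu M j : normalized_ws M ->
  omega_of M (mu M j.+1) = j.+1%:R * ln (mu M j.+1) - ln (M j.+1).
Proof.
move=> nM; have wM := nws_ws nM; have m0 := mu_gt0 j.+1 wM.
apply/eqP; rewrite eq_le omega_of_ub// andbT; apply: (omega_of_le wM) => // k.
have : ln (M j.+1 * mu M j.+1 ^+ k) <= ln (M k * mu M j.+1 ^+ j.+1).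
  rewrite ler_ln ?posrE ?mulr_gt0 ?exprn_gt0 ?(ws_gt0 wM)//; exact: ws_tangent.
by rewrite !ln_mulX ?(ws_gt0 wM)//; lra.
Qed.

(** A log-convex sequence is recovered by conjugation; for [k > 0] the supremum is attained at
    [ln (mu M k)], which is admissible since [mu M k >= 1]. *)
Lemma Omega_omega_of M k : normalized_ws M -> weight_function (omega_of M) ->
  Omega (omega_of M) 1 k = M k.
Proof.
move=> nM ww; have wM := nws_ws nM.
rewrite /Omega invr1 !mul1r -[RHS]lnK ?posrE ?(ws_gt0 wM)//; congr expR.
apply/eqP; rewrite eq_le; apply/andP; split.
  apply: phistar_le => y _.
  by have := omega_of_ub k wM (expR_gt0 y); rewrite expRK; lra.
case: k => [|k]; first by rewrite (nws_0 nM) ln1 (phistar_ge0 ww).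
have m1 := mu_ge1 k nM; have m0 : 0 < mu M k.+1 := mu_gt0 k.+1 wM.
apply: le_trans (phistar_ub ww k.+1%:R (ln_ge0 m1)).
by rewrite lnK ?posrE// omega_of_mu//; lra.
Qed.

(** The summand $\log^+(t/\mu_j)$ in $\omega_M(t)=\sum_{j\ge1}\log^+(t/\mu_j)$. As [mu M 0] equals 1
    for positive [M], index 0 stands for $\log^+t$. *)
Definition lnp_ratio M (t : R) j : R := Num.max 0 (ln t - ln (mu M j)).

(** Since [mu] is nondecreasing, positivity of the last summand lets all maxima be dropped, leaving
    the term of index [n]; otherwise the last summand is 0. *)
Lemma sum_lnp_ratio_le M t n : normalized_ws M -> 0 < t ->
  \sum_(j < n) lnp_ratio M t j.+1 <= omega_of M t.
Proof.
move=> nM t0; have wM := nws_ws nM.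
have lnM_sum k : ln (M k) = \sum_(j < k) ln (mu M j.+1).
  elim: k => [|k IH]; first by rewrite big_ord0 (nws_0 nM) ln1.
  by rewrite big_ord_recr/= -IH ln_mu.
elim: n => [|n IH]; first by rewrite big_ord0 omega_of_ge0// ltW.
have [le0|gt0] := leP (ln t - ln (mu M n.+1)) 0.
  by rewrite big_ord_recr/= {2}/lnp_ratio max_l// addr0.
apply: le_trans (omega_of_ub n.+1 wM t0).
rewrite lnM_sum mulr_natl -[X in ln t *+ X](card_ord n.+1) -sumr_const -sumrB.
apply: ler_sum => j _; rewrite /lnp_ratio max_r//.
apply: le_trans (ltW gt0) _; rewrite lerD2l lerN2 ler_ln ?posrE ?mu_gt0//.
by apply: mu_nondecreasing => //; rewrite -ltnS.
Qed.

Lemma le_sum_lnp_ratio M t n p : normalized_ws M -> (p < n)%N -> 0 < t ->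
  p%:R * ln t - ln (M p) <= \sum_(j < n) lnp_ratio M t j.
Proof.
move=> nM pn t0; have wM := nws_ws nM.
have g0 j : 0 <= lnp_ratio M t j by rewrite /lnp_ratio le_max lexx.
apply: (@le_trans _ _ (\sum_(j < p.+1) lnp_ratio M t j)); last first.
  rewrite -!(big_mkord xpredT (lnp_ratio M t)) [leRHS](big_cat_nat _ pn)//=.
  by rewrite lerDl sumr_ge0// => j _; exact: g0.
elim: p {pn} => [|p IH].
  rewrite (nws_0 nM) ln1 mul0r subr0 sumr_ge0// => j _; exact: g0.
rewrite big_ord_recr /= -natr1 ln_mu//.
have : ln t - ln (mu M p.+1) <= lnp_ratio M t p.+1 by rewrite /lnp_ratio le_max lexx orbT.
by move: IH; rewrite mulrDl mul1r; lra.
Qed.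

Lemma beta3_iter M : normalized_ws M -> beta3 M ->
  exists Q P, [/\ (0 < Q)%N, (0 < P)%N &
    forall p, (P <= p)%N -> 2 * mu M p <= mu M (Q * p)].
Proof.
move=> nM [Q Q0 /limn_einf_gt[a a1 [P _ HP]]]; have wM := nws_ws nM.
have {}HP p : (P <= p)%N -> a * mu M p <= mu M (Q * p).
  by move=> /HP /=; rewrite ler_pdivlMr ?mu_gt0.
have a0 : 0 < a by rewrite (lt_trans _ a1).
have iterP n p : (P <= p)%N -> a ^+ n * mu M p <= mu M (Q ^ n * p).
  elim: n p => [|n IH] p Pp; first by rewrite mul1r expn0 mul1n.
  rewrite exprSr -mulrA; apply: le_trans (ler_wpM2l (exprn_ge0 n (ltW a0)) (HP _ Pp)) _.
  rewrite expnSr -mulnA; apply: IH.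
  by rewrite (leq_trans Pp)// leq_pmull.
have [n Hn] := expr_unbounded 2 a1.
exists (Q ^ n)%N, P.+1; split=> // [|p /ltnW Pp]; first by rewrite expn_gt0 Q0.
apply: le_trans (iterP n _ Pp); rewrite ler_wpM2r ?(ltW (mu_gt0 _ wM))//.
exact: Hn.
Qed.

(** Monotonicity extends to index 0 because [mu M 0] is 1. *)
Lemma mu_le M i j : normalized_ws M -> (i <= j)%N -> mu M i <= mu M j.
Proof.
move=> nM ij; have wM := nws_ws nM; case: i ij => [|i]; last first.
  by case: j => // j ij; exact: mu_nondecreasing.
case: j => // j _; rewrite {1}/mu /= divff ?gt_eqF ?(ws_gt0 wM)//.
exact: mu_ge1.
Qed.

(* Cutting the factors of [(2 t) ^+ p / M p] into blocks of length [Q], each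
   factor of the [i]-th block is at most [t / mu_i], up to finitely many blocks. *)
Lemma beta3_omega1 M : normalized_ws M -> beta3 M ->
  affine_dom (fun t => omega_of M (2 * t)) (omega_of M).
Proof.
move=> nM bM; have wM := nws_ws nM.
have [Q [P [Q0 P0 HP]]] := beta3_iter nM bM.
have lM1 : 0 <= ln (M 1%N) by rewrite ln_ge0// nws_1.
pose K : R := Q%:R * (P%:R + 1).
have K0 : 0 < K by rewrite mulr_gt0 ?ltr0n// ltr_wpDl.
exists (K * (1 + ln (M 1%N)) + Q%:R) => [|t].
  by rewrite addr_gt0 ?ltr0n// mulr_gt0// ltr_wpDr.
rewrite le_eqVlt => /predU1P[<-|t0].
  by rewrite mulr0 /omega_of ltxx mulr0 add0r addr_ge0// mulr_ge0 ?addr_ge0// ltW.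
have t20 : 0 < 2 * t by rewrite mulr_gt0.
have w0 := omega_of_ge0 nM (ltW t0).
(* A common bound for every summand at [2 * t], spent on the first [P] blocks; the term of index 1
   bounds it by [omega_of M t]. *)
pose l := Num.max 0 (ln (2 * t)).
have l0 : 0 <= l by rewrite /l le_max lexx.
have lw : l <= 1 + (omega_of M t + ln (M 1%N)).
  rewrite /l ge_max addr_ge0//= ?addr_ge0// ln_mul2// lerD//.
    by have := ln_sublinear (ltr0n R 2); have := @le_ln1Dx R 1; lra.
  by have := omega_of_ub 1 wM t0; rewrite mul1r; lra.
have g0 s j : 0 <= lnp_ratio M s j by rewrite /lnp_ratio le_max lexx.
have gl j : lnp_ratio M (2 * t) j <= l.
  rewrite /l /lnp_ratio ge_max !le_max lexx/=; apply/orP; right.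
  rewrite lerBlDr lerDl ln_ge0//.
  by case: j => [|j]; [rewrite /mu divff// gt_eqF// (ws_gt0 wM)|exact: mu_ge1].
(* [minn n P] counts the blocks to which [HP] does not apply. *)
have blocks n : \sum_(0 <= j < Q * n) lnp_ratio M (2 * t) j <=
    Q%:R * ((minn n P)%:R * l + \sum_(0 <= i < n) lnp_ratio M t i).
  elim: n => [|n IH].
    by rewrite muln0 !big_geq// min0n mul0r addr0 mulr0.
  have Qn : (Q * n <= Q * n.+1)%N by rewrite leq_mul.
  rewrite (big_cat_nat _ Qn)//= big_nat_recr//=.
  suff : \sum_(Q * n <= j < Q * n.+1) lnp_ratio M (2 * t) j <=
      Q%:R * ((n < P)%N%:R * l + lnp_ratio M t n).
    have -> : (minn n.+1 P)%:R = (minn n P)%:R + (n < P)%N%:R :> R.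
      by rewrite -natrD; congr _%:R; case: ltnP; lia.
    by move: IH; lra.
  apply: (@le_trans _ _ (\sum_(Q * n <= j < Q * n.+1) ((n < P)%N%:R * l + lnp_ratio M t n))).
    rewrite big_seq_cond [leRHS]big_seq_cond; apply: ler_sum => j.
    rewrite mem_index_iota andbT => /andP[nj _].
    have [nP|Pn] := ltnP n P; first by rewrite mul1r (le_trans (gl j))// lerDl.
    rewrite mul0r add0r /lnp_ratio ge_max !le_max lexx/=; apply/orP; right.
    have mj : 2 * mu M n <= mu M j by apply: le_trans (HP _ Pn) (mu_le nM nj).
    have mn0 := mu_gt0 n wM; have mj0 := mu_gt0 j wM.
    have : ln (2 * mu M n) <= ln (mu M j) by rewrite ler_ln ?posrE//; exact: mulr_gt0.
    by rewrite !ln_mul2//; lra.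
  by rewrite sumr_const_nat -mulnBr subSnn muln1 -[leLHS]mulr_natl.
apply: (omega_of_le wM) => // p.
have pQ : (p < Q * p.+1)%N by rewrite (leq_trans (ltnSn p))// leq_pmull.
apply: le_trans (le_sum_lnp_ratio nM pQ t20) _.
have := blocks p.+1; rewrite big_mkord => /le_trans; apply.
have h1 : (minn p.+1 P)%:R * l <= P%:R * l by rewrite ler_wpM2r// ler_nat geq_minr.
(* The summand of index 0 is split off, as [sum_lnp_ratio_le] starts at 1. *)
have h2 : \sum_(0 <= i < p.+1) lnp_ratio M t i <= l + omega_of M t.
  rewrite big_nat_recl// lerD//; last by rewrite big_mkord sum_lnp_ratio_le.
  apply: le_trans (gl 0%N); rewrite /lnp_ratio ge_max !le_max lexx/=.
  apply/orP; right; rewrite lerD2r.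
  by rewrite ler_ln ?posrE//; lra.
apply: le_trans (_ : Q%:R * ((P%:R + 1) * l + omega_of M t) <= _).
  by rewrite ler_wpM2l//; lra.
rewrite mulrDr mulrA -/K.
have := ler_wpM2l (ltW K0) lw.
have : 0 <= K * ln (M 1%N) * omega_of M t by rewrite !mulr_ge0// ltW.
have : 0 <= Q%:R :> R by [].
by nra.
Qed.

(** By (mg) and two uses of (omega_1), $\omega_M(4\mu_p)\le Kp$. If $\mu_{Qp}<2\mu_p$, the term of
    index $Qp$ gives $\omega_M(4\mu_p)\ge Qp\ln2$, which is impossible for $Q\ln2>K$. *)
Lemma mg_omega1_beta3 M : normalized_ws M -> mg M ->
  affine_dom (fun t => omega_of M (2 * t)) (omega_of M) -> beta3 M.
Proof.
move=> nM [C C1 CM] [L L0 HL]; have wM := nws_ws nM.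
have C0 : 0 < C := lt_le_trans ltr01 C1.
pose K := L * (L * (2 * ln C)) + L * L + L.
have lC : 0 <= ln C by exact: ln_ge0.
have K0 : 0 <= K by rewrite /K !addr_ge0 ?mulr_ge0 ?(ltW L0).
have ln2 : 0 < ln 2 :> R by rewrite ln_gt0// ltr1n.
pose Q := (Num.truncn (K / ln 2)).+1.
have QK : K < Q%:R * ln 2.
  by rewrite -ltr_pdivrMr//; have /andP[] := truncn_itv (divr_ge0 K0 (ltW ln2)).
exists Q => //; apply: (@lt_le_trans _ _ 2%:E); first by rewrite lte_fin ltr1n.
apply: limn_einf_ge; exists 1%N => // -[//|p _] /=.
rewrite ler_pdivlMr ?mu_gt0// leNgt; apply/negP => lt2.
have m0 : 0 < mu M p.+1 := mu_gt0 p.+1 wM.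
(* The tangent at [p.+1], read off at twice that index, combines with (mg) into $M_n\mu_n^n\le
   M_{2n}\le C^{2n}M_n^2$ for $n=p+1$. *)
have wmu : omega_of M (mu M p.+1) <= p.+1%:R * (2 * ln C).
  rewrite omega_of_mu//.
  have := ws_tangent p (p.+1 + p.+1) wM; rewrite exprD mulrA.
  rewrite ler_pM2r ?exprn_gt0// => /le_trans /(_ (CM _ _)) h.
  have : ln (M p.+1 * mu M p.+1 ^+ p.+1) <= ln (C ^+ (p.+1 + p.+1) * M p.+1 * M p.+1).
    by rewrite ler_ln ?posrE ?mulr_gt0 ?exprn_gt0 ?(ws_gt0 wM).
  rewrite ln_mulX ?(ws_gt0 wM)// -[C ^+ _ * _ * _]mulrA [C ^+ _ * _]mulrC.
  by rewrite ln_mulX ?mulr_gt0 ?(ws_gt0 wM)// lnM ?posrE ?(ws_gt0 wM)// natrD; lra.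
have wm4 : omega_of M (2 * (2 * mu M p.+1)) <= p.+1%:R * K.
  have p1 : 1 <= p.+1%:R :> R by rewrite ler1n.
  have h1 := HL _ (ltW m0); have h2 := HL (2 * mu M p.+1) (mulr_ge0 (ler0n R 2) (ltW m0)).
  have h3 := ler_wpM2l (ltW L0) (ler_wpM2l (ltW L0) wmu).
  have h4 := ler_wpM2l (ltW L0) h1.
  have h5 : L * L + L <= p.+1%:R * (L * L + L) by rewrite ler_peMl// addr_ge0 ?mulr_ge0 ?(ltW L0).
  by rewrite /K; nra.
have Qp : (Q * p.+1 = (Q * p.+1).-1.+1)%N by rewrite prednK// muln_gt0.
set q := (Q * p.+1)%N in lt2 Qp.
have q0 : 0 < mu M q := mu_gt0 q wM.
have lMq : ln (M q) <= q%:R * ln (mu M q).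
  have := ws_tangent q.-1 0 wM; rewrite -Qp expr0 mulr1 (nws_0 nM) mul1r.
  by move=> h; rewrite mulr_natl -lnXn// ler_ln ?posrE ?exprn_gt0 ?(ws_gt0 wM).
have lmq : ln (mu M q) <= ln (2 * mu M p.+1).
  by rewrite ler_ln ?posrE ?ltW//; exact: mulr_gt0.
have m20 : 0 < 2 * mu M p.+1 by exact: mulr_gt0.
have := omega_of_ub q wM (mulr_gt0 (ltr0n R 2) m20).
move=> /le_trans /(_ wm4); rewrite ln_mul2//.
have := ler_wpM2l (ler0n R q) lmq.
have : p.+1%:R * K < p.+1%:R * (Q%:R * ln 2) by rewrite ltr_pM2l.
have : q%:R * ln 2 = p.+1%:R * (Q%:R * ln 2) :> R by rewrite /q natrM; ring.
by rewrite mulrDr; lra.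
Qed.

Definition factorial_growth (c : R) M : Prop :=
  \forall p \near \oo, c ^+ p * p`!%:R <= M p.

Lemma root_fact_ge M p (c : R) : (forall k, 0 < M k) -> 0 <= c -> (0 < p)%N ->
  (c <= root_fact M p) = (c ^+ p * p`!%:R <= M p).
Proof.
move=> M0 c0 p0; have f0 : 0 < p`!%:R :> R by rewrite ltr0n fact_gt0.
have x0 : 0 < M p / p`!%:R by rewrite divr_gt0.
have pn0 : p%:R != 0 :> R by rewrite pnatr_eq0 -lt0n.
rewrite -ler_pdivlMr// /root_fact -(@ler_pXn2r _ p)//; last first.
  by rewrite nnegrE powR_ge0.
by rewrite -(powR_mulrn _ (powR_ge0 _ _)) -powRrM mulVf// powRr1// ltW.
Qed.

Lemma root_fact_near M (c : R) : (forall k, 0 < M k) -> 0 <= c ->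
  (\forall p \near \oo, c <= root_fact M p) <-> factorial_growth c M.
Proof.
move=> M0 c0; split=> -[P _ HP]; exists P.+1 => // p Pp;
  have p0 : (0 < p)%N by exact: leq_ltn_trans Pp.
  by rewrite -root_fact_ge//; apply: HP; exact: ltnW.
by rewrite /= root_fact_ge//; apply: HP; exact: ltnW.
Qed.

Lemma limn_einf_root_fact M : (forall k, 0 < M k) ->
  (0 < limn_einf (fun p => (root_fact M p)%:E))%E <->
  exists2 c, 0 < c & factorial_growth c M.
Proof.
move=> M0; split=> [/limn_einf_gt[c c0 /root_fact_near h]|[c c0 /root_fact_near h]].
  by exists c => //; apply: h => //; exact: ltW.
apply: (@lt_le_trans _ _ c%:E) => //; apply: limn_einf_ge; apply: h => //.
exact: ltW.
Qed.

Lemma cvg_root_fact M : (forall k, 0 < M k) ->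
  root_fact M p @[p --> \oo] --> +oo <-> forall c, 0 < c -> factorial_growth c M.
Proof.
move=> M0; split=> [/cvgryPge h c c0|h].
  by apply/root_fact_near => //; exact: ltW.
apply/cvgryPge => A; have A1 : 0 < `|A| + 1 by rewrite ltr_wpDl.
have /root_fact_near h1 := h _ A1; have := h1 M0 (ltW A1).
apply: filterS => p; apply: le_trans.
by rewrite (le_trans (ler_norm A))// lerDl.
Qed.

Lemma factorial_growth_gdom c C M N : 0 < C ->
  (forall k, M k <= C ^+ k * N k) -> factorial_growth c M -> factorial_growth (c / C) N.
Proof.
move=> C0 CP; apply: filterS => p h.
rewrite expr_div_n mulrAC ler_pdivrMr ?exprn_gt0// mulrC [N p * _]mulrC.
by apply: le_trans (CP p); rewrite mulrC.
Qed.

(** Each summand of the exponential series of $t/c$ is at most $e^{t/c}$; [K] covers the finitely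
    many indices before the growth sets in. *)
Lemma factorial_growth_omega c M : normalized_ws M -> 0 < c -> factorial_growth c M ->
  exists2 K, 0 <= K & forall t, 0 <= t -> omega_of M t <= c^-1 * t + K.
Proof.
move=> nM c0 [P _ HP]; have wM := nws_ws nM.
exists (\sum_(p < P) `|ln (c ^+ p * p`!%:R)|) => [|t]; first exact: sumr_ge0.
rewrite le_eqVlt => /predU1P[<-|t0].
  by rewrite /omega_of ltxx mulr0 add0r sumr_ge0.
apply: (omega_of_le wM) => // p.
have f0 : 0 < c ^+ p * p`!%:R by rewrite mulr_gt0 ?exprn_gt0 ?ltr0n ?fact_gt0.
have tp : p%:R * ln t <= c^-1 * t + ln (c ^+ p * p`!%:R).
  have x0 : 0 <= c^-1 * t by rewrite mulr_ge0 ?invr_ge0 ?ltW.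
  rewrite mulr_natl -lnXn// -[c^-1 * t]expRK -lnM ?posrE ?expR_gt0//.
  rewrite ler_ln ?posrE ?mulr_gt0 ?exprn_gt0 ?expR_gt0 ?ltr0n ?fact_gt0//.
  have : (c^-1 * t) ^+ p / p`!%:R <= expR (c^-1 * t).
    case: p {f0} => [|p]; first by rewrite fact0 divr1 expr0 -expR0 ler_expR.
    by apply: le_trans (expR_ge1Dxn p x0); rewrite lerDr.
  rewrite -(ler_pM2r f0); apply: le_trans; rewrite le_eqVlt; apply/orP; left; apply/eqP.
  have cp : c ^+ p != 0 by rewrite expf_neq0// gt_eqF.
  have fp : p`!%:R != 0 :> R by rewrite pnatr_eq0 -lt0n fact_gt0.
  rewrite exprMn exprVn; move: (c ^+ p) (p`!%:R : R) (t ^+ p) cp fp => a b x a0 b0.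
  by field; rewrite a0 b0.
have [Pp|pP] := leqP P p.
  have : ln (c ^+ p * p`!%:R) <= ln (M p).
    by rewrite ler_ln ?posrE ?(ws_gt0 wM)//; exact: HP.
  have : 0 <= \sum_(p < P) `|ln (c ^+ p * p`!%:R)| by exact: sumr_ge0.
  by lra.
have : 0 <= ln (M p) by rewrite ln_ge0// nws_ge1.
have : ln (c ^+ p * p`!%:R) <= \sum_(p < P) `|ln (c ^+ p * p`!%:R)|.
  apply: le_trans (ler_norm _) _.
  by rewrite (bigD1 (Ordinal pP))//= lerDl sumr_ge0.
by lra.
Qed.

End AssociatedFunctionGrowth.

(** * The equivalences *)

Section Equivalence.
Context {R : realType}.
Implicit Types (M N : nat -> R) (w u v : R -> R).

Lemma affine_dom_scale u (C : R) : 0 < C ->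
  (forall s t, 0 <= s -> s <= t -> u s <= u t) -> (forall t, 0 <= t -> 0 <= u t) ->
  affine_dom (fun t => u (2 * t)) u -> affine_dom (fun t => u (C * t)) u.
Proof.
move=> C0 umon u0 u2.
have pow2 n : affine_dom (fun t => u (2 ^+ n * t)) u.
  elim: n => [|n IH].
    by exists 1 => // t _; rewrite expr0 !mul1r lerDl.
  apply: (affine_dom_trans u0 _ u2); have [L L0 HL] := IH.
  exists L => // t t0; have := HL _ (mulr_ge0 (ler0n R 2) t0).
  by rewrite mulrA -exprSr.
have [n Hn] := expr_unbounded C (ltr1n R 2).
have [L L0 HL] := pow2 n; exists L => // t t0; apply: le_trans (HL _ t0).
by apply: umon; [rewrite mulr_ge0// ltW|rewrite ler_wpM2r// Hn].
Qed.

(** The domination gives $\omega_M(t)\le\omega_N(Ct)$, and (omega_1) removes the dilation. *)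
Lemma omega_of_gdom M N : normalized_ws M -> normalized_ws N -> gdom N M ->
  affine_dom (fun t => omega_of N (2 * t)) (omega_of N) ->
  affine_dom (omega_of M) (omega_of N).
Proof.
move=> nM nN [C C0 CP] N2.
have [s t|t|L L0 HL] := affine_dom_scale C0 _ _ N2.
- exact: omega_of_increasing.
- exact: omega_of_ge0.
exists L => // t t0; apply: le_trans (HL _ t0).
move: t0; rewrite le_eqVlt => /predU1P[<-|t0]; first by rewrite mulr0 /omega_of ltxx.
apply: (omega_of_le (nws_ws nM)) => // p.
apply: le_trans (omega_of_ub p (nws_ws nN) (mulr_gt0 C0 t0)).
have N0 := ws_gt0 (nws_ws nN) p; have M0 := ws_gt0 (nws_ws nM) p.
have : ln (N p) <= ln (M p * C ^+ p).
  by rewrite ler_ln ?posrE ?mulr_gt0 ?exprn_gt0// mulrC.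
by rewrite ln_mulX// lnM ?posrE//; lra.
Qed.

Lemma omega_Omega_affine_dom w l : weight_function w -> 0 < l ->
  affine_dom (omega_of (Omega w l)) w /\ affine_dom w (omega_of (Omega w l)).
Proof.
move=> ww l0; have nO := Omega_nws ww l0; split.
  exists l^-1 => [|t t0]; first by rewrite invr_gt0.
  apply: le_trans (omega_Omega_le ww l0 t0) _.
  by rewrite lerDl invr_ge0 ltW.
have O1 : 0 <= ln (Omega w l 1%N) by rewrite ln_ge0// nws_1.
(* The error [ln t] of [le_omega_Omega] is bounded by the term of index 1, which doubles the
   coefficient of [omega_of]. *)
exists (2 * l + l * ln (Omega w l 1%N)) => [|t t0].
  by rewrite ltr_wpDr ?mulr_ge0 ?mulr_gt0// ltW.
have w0 := omega_of_ge0 nO t0.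
have c0 : 0 <= 2 * l + l * ln (Omega w l 1%N) by rewrite addr_ge0 ?mulr_ge0 ?(ltW l0).
have [t1|/ltW t1] := leP t 1.
  by rewrite (wf_vanish ww) ?t0// addr_ge0// mulr_ge0.
have := le_omega_Omega ww l0 t1; rewrite ler_pdivrMl// => h.
have := omega_of_ub 1 (nws_ws nO) (lt_le_trans ltr01 t1); rewrite mul1r => h2.
have := ler_wpM2l (ltW l0) h2.
have : 0 <= l * ln (Omega w l 1%N) * omega_of (Omega w l) t by rewrite !mulr_ge0// ltW.
by nra.
Qed.

Lemma omega_Omega_omega1 w l : weight_function w -> 0 < l ->
  affine_dom (fun t => omega_of (Omega w l) (2 * t)) (omega_of (Omega w l)).
Proof.
move=> ww l0; have nO := Omega_nws ww l0.
have [[L L0 HL] wO] := omega_Omega_affine_dom ww l0.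
have w2 : affine_dom (fun t => w (2 * t)) w.
  apply: bigO_affine_dom (wf_omega1 ww); last exact: wf_ge0 ww.
  move=> s t s0 st; apply: (wf_increasing ww); first exact: mulr_ge0.
  by rewrite ler_wpM2l.
have O0 t : 0 <= t -> 0 <= omega_of (Omega w l) t by exact: omega_of_ge0.
apply: affine_dom_trans O0 _ (affine_dom_trans O0 w2 wO).
by exists L => // t t0; apply: HL; exact: mulr_ge0.
Qed.

(** The squeeze at one parameter gives the doubling property, which carries the equivalence with [N]
    to every [l]. *)
Lemma class_eq_Omega ty w N : weight_function w -> normalized_ws N ->
  class_eq (E_fun ty w) (E_seq ty N) ->
  phistar_doubling w /\
  forall l, 0 < l -> gdom N (Omega w l) /\ gdom (Omega w l) N.
Proof.
move=> ww nN /(class_eq_gdom ww nN)[l0 l00 [ON NO]].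
have dbl := gdom_phistar_doubling ww l00 (gdom_trans ON NO).
have l20 : 0 < 2 * l0 by rewrite mulr_gt0.
split => // l l0'; split.
  exact: gdom_trans NO (phistar_doubling_gdom ww dbl l00 l0').
exact: gdom_trans (phistar_doubling_gdom ww dbl l0' l20) ON.
Qed.

Lemma class_eq_sym (E E' : class R) : class_eq E E' -> class_eq E' E.
Proof. by move=> h r s r0 s0 U oU U0; rewrite (h r s r0 s0 U). Qed.

Lemma class_eq_trans (E E' E'' : class R) :
  class_eq E E' -> class_eq E' E'' -> class_eq E E''.
Proof.
by move=> h h' r s r0 s0 U oU U0; rewrite (h r s r0 s0 U)// (h' r s r0 s0 U).
Qed.

Lemma affine_dom_wf_bigO u v : weight_function u -> weight_function v ->
  affine_dom u v -> u =O_ at_pinfty v.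
Proof.
move=> wu wv; apply: affine_dom_bigO; first exact: wf_ge0 wu.
exact: wf_infty wv.
Qed.

Lemma omega_of_weight_function_beta3 N : normalized_ws N -> beta3 N ->
  weight_function (omega_of N).
Proof.
by move=> nN bN; apply: omega_of_weight_function => //; exact: beta3_omega1.
Qed.

Lemma mg_class_eq ty N : normalized_ws N -> beta3 N -> mg N ->
  class_eq (E_fun ty (omega_of N)) (E_seq ty N).
Proof.
move=> nN bN mgN; have wN := omega_of_weight_function_beta3 nN bN.
have dbl := omega6_phistar_doubling wN (mg_omega6 nN mgN).
have l1 : 0 < 1 :> R by [].
have NE : N = Omega (omega_of N) 1.
  by apply/funext => k; rewrite Omega_omega_of.
apply: E_fun_seq => // l l0.
  by rewrite {1}NE; exact: phistar_doubling_gdom.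
by rewrite {2}NE; exact: phistar_doubling_gdom.
Qed.

Lemma class_eq_mg ty w N : weight_function w -> normalized_ws N ->
  class_eq (E_fun ty w) (E_seq ty N) -> mg N.
Proof.
move=> ww nN /(class_eq_Omega ww nN)[dbl NO].
have l1 : 0 < 1 :> R by []; have [N1 O1] := NO _ l1.
apply: mg_gdom N1 O1 (Omega_mg ww dbl l1) => k; last exact: expR_gt0.
exact: ws_gt0 (nws_ws nN) k.
Qed.

End Equivalence.

Unset Implicit Arguments.

Theorem theorem6p2 (R : realType) (N : nat -> R) (hN : LC N) (hb : beta3 N)
    (ty : class_type) :
  [<-> (exists2 w : R -> R, weight_function w &
          class_eq (E_fun ty w) (E_seq ty N));
       mg N;
       class_eq (E_fun ty (omega_of N)) (E_seq ty N)]
  /\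
  forall w : R -> R, weight_function w ->
    class_eq (E_fun ty w) (E_seq ty N) ->
  forall l : R, 0 < l ->
    (* (a) *)
    ((weight_function w /\ omega6 w) /\
     (weight_function (omega_of (Omega w l)) /\ omega6 (omega_of (Omega w l))) /\
     (weight_function (omega_of N) /\ omega6 (omega_of N))) /\
    (* (b) *)
    (wf_equiv (omega_of (Omega w l)) w /\ wf_equiv w (omega_of N)) /\
    (* (c) *)
    (class_eq (E_fun ty (omega_of N)) (E_seq ty N) /\
     class_eq (E_seq ty N) (E_fun ty w) /\
     class_eq (E_fun ty w) (E_seq ty (Omega w l))) /\
    (* (d) *)
    ws_equiv N (Omega w l) /\
    (* (e) *)
    mg (Omega w l) /\
    (* (f) *)
    ((0 < limn_einf (fun p => (root_fact N p)%:E))%E ->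
       omega2 w /\ omega2 (omega_of N) /\ omega2 (omega_of (Omega w l)) /\
       beta3 (Omega w l) /\
       (0 < limn_einf (fun p => (root_fact (Omega w l) p)%:E))%E) /\
    (root_fact N p @[p --> \oo] --> +oo ->
       omega5 w /\ omega5 (omega_of N) /\ omega5 (omega_of (Omega w l)) /\
       root_fact (Omega w l) p @[p --> \oo] --> +oo).
Proof.
have nN := LC_nws hN; have N0 := ws_gt0 (nws_ws nN).
have wN := omega_of_weight_function_beta3 nN hb.
split.
  tfae; [|exact: mg_class_eq|by exists (omega_of N)].
  by case=> w ww; exact: class_eq_mg.
move=> w ww wE l l0.
have [dbl NO] := class_eq_Omega ww nN wE.
have nO := Omega_nws ww l0; have O0 := ws_gt0 (nws_ws nO).
have mgN := class_eq_mg ww nN wE.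
have mgO := Omega_mg ww dbl l0.
have [NOl ONl] := NO _ l0.
have O1 := omega_Omega_omega1 ww l0.
have N1 := beta3_omega1 nN hb.
have wO := omega_of_weight_function nO O1.
have [Ow wO'] := omega_Omega_affine_dom ww l0.
have ON' := omega_of_gdom nO nN NOl N1.
have NO' := omega_of_gdom nN nO ONl O1.
(* [w] and [omega_of N] are compared through [omega_of (Omega w l)]. *)
have wN' := affine_dom_trans (wf_ge0 wN) wO' ON'.
have Nw := affine_dom_trans (wf_ge0 ww) NO' Ow.
split; first by do !split => //; [exact: phistar_doubling_omega6|exact: mg_omega6|exact: mg_omega6].
split; first by do !split; exact: affine_dom_wf_bigO.
split.
  do !split; [exact: mg_class_eq|exact: class_eq_sym|].
  exact: class_eq_trans wE (E_seq_equiv ty nN nO NOl ONl).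
split; first by split; exact: gdom_ws_le.
split => //; have [C C0 CP] := NOl.
have t0 (t : R) : 0 <= t -> 0 <= t by [].
split=> [/(limn_einf_root_fact N0)[c c0 cN]|/(cvg_root_fact N0) cN].
  have N2 : affine_dom (omega_of N) id.
    have [K K0 HK] := factorial_growth_omega nN c0 cN.
    exists (c^-1 + K) => [|t tt]; first by rewrite ltr_wpDr// invr_gt0.
    apply: le_trans (HK _ tt) _; rewrite mulrDl.
    have : 0 <= K * t by exact: mulr_ge0.
    have : 0 <= c^-1 by rewrite invr_ge0 ltW.
    by rewrite /=; lra.
  have om2 (u : R -> R) : weight_function u -> affine_dom u (omega_of N) -> omega2 u.
    move=> wu uN; apply: affine_dom_bigO (affine_dom_trans t0 uN N2).
      exact: wf_ge0 wu.
    by apply/cvgryPge => A; apply: nbhs_pinfty_ge; exact: num_real.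
  have NN : affine_dom (omega_of N) (omega_of N).
    by exists 1 => // t _; rewrite mul1r lerDl.
  split; first exact: om2 ww wN'.
  split; first exact: om2 wN NN.
  split; first exact: om2 wO ON'.
  split; first exact: mg_omega1_beta3.
  apply/(limn_einf_root_fact O0); exists (c / C); first exact: divr_gt0.
  exact: factorial_growth_gdom cN.
have om5 (u : R -> R) : weight_function u -> affine_dom u (omega_of N) -> omega5 u.
  move=> wu [L L0 HL]; apply: littleo_idP => [|e e0]; first exact: wf_ge0 wu.
  (* With this [c], the slope [L * c^-1] equals [e]. *)
  have c0 : 0 < L / e by rewrite divr_gt0.
  have [K K0 HK] := factorial_growth_omega nN c0 (cN _ c0).
  exists (L * K + L) => [|t tt]; first by rewrite addr_ge0 ?mulr_ge0// ltW.
  apply: le_trans (HL _ tt) _; rewrite addrA lerD2r.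
  apply: le_trans (ler_wpM2l (ltW L0) (HK _ tt)) _.
  by rewrite invf_div mulrDr lerD2r mulrA mulrCA mulfV ?mulr1// gt_eqF.
have NN : affine_dom (omega_of N) (omega_of N).
  by exists 1 => // t _; rewrite mul1r lerDl.
split; first exact: om5 ww wN'.
split; first exact: om5 wN NN.
split; first exact: om5 wO ON'.
apply/(cvg_root_fact O0) => c c0.
(* The passage from [N] to [Omega w l] divides the growth constant by [C]. *)
have cC : 0 < c * C by exact: mulr_gt0.
have := factorial_growth_gdom C0 CP (cN _ cC).
by rewrite mulfK// gt_eqF.
Qed.
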